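(* Let $R>0$ and $\alpha>0$. The monomials $e_n(q):=q^n$, $n=0,1,2,\dots$, form an orthogonal basis of the slice hyperholomorphic Bergman space $A^{2,\alpha}_{slice}(\mathbb{B}_R)$ with respect to its scalar product. The square norm of $e_n$ is given by $$\|e_n\|^2_{\alpha,slice}=\frac{n!\,R^{2n}\,\Gamma(\alpha+1)}{\Gamma(n+\alpha+1)}.$$
   Context: $\mathbb{H}$ is the algebra of quaternions, with conjugation $q\mapsto\overline q$ and modulus $|q|$; $\mathbb{S}=\{I\in\mathbb{H}: I^2=-1\}$; for $I\in\mathbb{S}$, $\mathbb{C}_I=\mathbb{R}+\mathbb{R}I$. $\mathbb{B}_R=\{q\in\mathbb{H}:|q|<R\}$ and $\mathbb{B}_{R,I}=\mathbb{B}_R\cap\mathbb{C}_I$. A real differentiable function $f:\mathbb{B}_R\to\mathbb{H}$ is (left) slice regular if for every $I\in\mathbb{S}$ its restriction $f_I$ to $\mathbb{B}_{R,I}$ has continuous partial derivatives and satisfies $\left(\frac{\partial}{\partial x}+I\frac{\partial}{\partial y}\right)f_I(x+yI)=0$. The slice hyperholomorphic Bergman space $A^{2,\alpha}_{slice}(\mathbb{B}_R)$ is the right $\mathbb{H}$-vector space of slice regular functions $f$ on $\mathbb{B}_R$ whose restriction to $\mathbb{B}_{R,I}$ is square integrable with respect to $d\lambda^\alpha_{I,R}(x+yI)=\frac{\alpha}{\pi R^2}\left(1-\frac{|x+yI|^2}{R^2}\right)^{\alpha-1}dx\,dy$ (the space does not depend on $I\in\mathbb{S}$). It is a right quaternionic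 Hilbert space with scalar product $\langle f,g\rangle_{\alpha,slice}=\int_{\mathbb{B}_{R,I}}\overline{f}\,g\,d\lambda^\alpha_{I,R}$ and norm $\|f\|_{\alpha,slice}=\langle f,f\rangle_{\alpha,slice}^{1/2}$. An orthogonal basis is a family of pairwise orthogonal nonzero elements whose right $\mathbb{H}$-linear span is dense. *)

(* Defs.v *)
From HB Require Import structures.
From mathcomp Require Import all_boot all_order all_algebra.
From mathcomp Require Import all_classical all_reals all_analysis.
From mathcomp Require Import ring lra.

Set Implicit Arguments.
Unset Strict Implicit.
Unset Printing Implicit Defensive.

Import Order.TTheory GRing.Theory Num.Theory.
Import numFieldNormedType.Exports.

Local Open Scope classical_set_scope.
Local Open Scope ring_scope.

Record quaternion (R : realType) : Type :=
  Quat { qre : R; qi : R; qj : R; qk : R }.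

Lemma quat_ext (R : realType) (p q : quaternion R) :
  qre p = qre q -> qi p = qi q -> qj p = qj q -> qk p = qk q -> p = q.
Proof. by case: p => a b c d; case: q => a' b' c' d' /= -> -> -> ->. Qed.

Definition quat_tuple (R : realType) (q : quaternion R) : R * R * R * R :=
  (qre q, qi q, qj q, qk q).

Definition tuple_quat (R : realType) (t : R * R * R * R) : quaternion R :=
  Quat t.1.1.1 t.1.1.2 t.1.2 t.2.

Lemma quat_tupleK (R : realType) : cancel (@quat_tuple R) (@tuple_quat R).
Proof. by case. Qed.

HB.instance Definition _ (R : realType) :=
  Choice.copy (quaternion R) (can_type (@quat_tupleK R)).

Definition quat_zero (R : realType) : quaternion R := Quat 0 0 0 0.

Definition quat_opp (R : realType) (p : quaternion R) : quaternion R :=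
  Quat (- qre p) (- qi p) (- qj p) (- qk p).

Definition quat_add (R : realType) (p q : quaternion R) : quaternion R :=
  Quat (qre p + qre q) (qi p + qi q) (qj p + qj q) (qk p + qk q).

Lemma quat_addA (R : realType) : associative (@quat_add R).
Proof. by move=> p q s; apply: quat_ext => /=; rewrite addrA. Qed.

Lemma quat_addC (R : realType) : commutative (@quat_add R).
Proof. by move=> p q; apply: quat_ext => /=; rewrite addrC. Qed.

Lemma quat_add0 (R : realType) : left_id (@quat_zero R) (@quat_add R).
Proof. by move=> p; apply: quat_ext => /=; rewrite add0r. Qed.

Lemma quat_addN (R : realType) :
  left_inverse (@quat_zero R) (@quat_opp R) (@quat_add R).
Proof. by move=> p; apply: quat_ext => /=; rewrite addNr. Qed.

HB.instance Definition _ (R : realType) := GRing.isZmodule.Build (quaternion R)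
  (@quat_addA R) (@quat_addC R) (@quat_add0 R) (@quat_addN R).

Definition quat_one (R : realType) : quaternion R := Quat 1 0 0 0.

Definition quat_mul (R : realType) (p q : quaternion R) : quaternion R :=
  Quat (qre p * qre q - qi p * qi q - qj p * qj q - qk p * qk q)
       (qre p * qi q + qi p * qre q + qj p * qk q - qk p * qj q)
       (qre p * qj q - qi p * qk q + qj p * qre q + qk p * qi q)
       (qre p * qk q + qi p * qj q - qj p * qi q + qk p * qre q).

Lemma quat_mulA (R : realType) : associative (@quat_mul R).
Proof. by move=> p q s; apply: quat_ext => /=; ring. Qed.

Lemma quat_mul1 (R : realType) : left_id (@quat_one R) (@quat_mul R).
Proof. by move=> p; apply: quat_ext => /=; ring. Qed.

Lemma quat_mulr1 (R : realType) : right_id (@quat_one R) (@quat_mul R).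
Proof. by move=> p; apply: quat_ext => /=; ring. Qed.

Lemma quat_mulDl (R : realType) : left_distributive (@quat_mul R) +%R.
Proof. by move=> p q s; apply: quat_ext => /=; ring. Qed.

Lemma quat_mulDr (R : realType) : right_distributive (@quat_mul R) +%R.
Proof. by move=> p q s; apply: quat_ext => /=; ring. Qed.

Lemma quat_one_neq0 (R : realType) : @quat_one R != 0.
Proof. by apply/eqP => -[] /eqP; rewrite oner_eq0. Qed.

HB.instance Definition _ (R : realType) :=
  GRing.Zmodule_isNzRing.Build (quaternion R)
    (@quat_mulA R) (@quat_mul1 R) (@quat_mulr1 R)
    (@quat_mulDl R) (@quat_mulDr R) (@quat_one_neq0 R).

Definition quat_scale (R : realType) (a : R) (p : quaternion R) : quaternion R :=
  Quat (a * qre p) (a * qi p) (a * qj p) (a * qk p).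

Lemma quat_scaleA (R : realType) (a b : R) (p : quaternion R) :
  quat_scale a (quat_scale b p) = quat_scale (a * b) p.
Proof. by apply: quat_ext => /=; rewrite mulrA. Qed.

Lemma quat_scale1 (R : realType) : left_id 1 (@quat_scale R).
Proof. by move=> p; apply: quat_ext => /=; rewrite mul1r. Qed.

Lemma quat_scaleDr (R : realType) : right_distributive (@quat_scale R) +%R.
Proof. by move=> a p q; apply: quat_ext => /=; rewrite mulrDr. Qed.

Lemma quat_scaleDl (R : realType) (p : quaternion R) :
  {morph (@quat_scale R)^~ p : a b / a + b}.
Proof. by move=> a b; apply: quat_ext => /=; rewrite mulrDl. Qed.

HB.instance Definition _ (R : realType) :=
  GRing.Zmodule_isLmodule.Build R (quaternion R)
    (@quat_scaleA R) (@quat_scale1 R) (@quat_scaleDr R) (@quat_scaleDl R).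

Lemma quat_scaleAl (R : realType) (a : R) (p q : quaternion R) :
  a *: (p * q) = (a *: p) * q.
Proof. by apply: quat_ext => /=; ring. Qed.

HB.instance Definition _ (R : realType) :=
  GRing.Lmodule_isLalgebra.Build R (quaternion R) (@quat_scaleAl R).

Lemma quat_scaleAr (R : realType) (a : R) (p q : quaternion R) :
  a *: (p * q) = p * (a *: q).
Proof. by apply: quat_ext => /=; ring. Qed.

HB.instance Definition _ (R : realType) :=
  GRing.Lalgebra_isAlgebra.Build R (quaternion R) (@quat_scaleAr R).

Definition qconj (R : realType) (p : quaternion R) : quaternion R :=
  Quat (qre p) (- qi p) (- qj p) (- qk p).

Definition quat_sqn (R : realType) (p : quaternion R) : R :=
  qre p ^+ 2 + qi p ^+ 2 + qj p ^+ 2 + qk p ^+ 2.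

Lemma quat_sqn_ge0 (R : realType) (p : quaternion R) : 0 <= quat_sqn p.
Proof. by rewrite /quat_sqn !addr_ge0// sqr_ge0. Qed.

Definition quat_modulus (R : realType) (p : quaternion R) : R :=
  Num.sqrt (quat_sqn p).

Lemma quat_modulusD (R : realType) (p q : quaternion R) :
  quat_modulus (p + q) <= quat_modulus p + quat_modulus q.
Proof.
have s0 : 0 <= quat_modulus p + quat_modulus q by rewrite addr_ge0 ?sqrtr_ge0.
rewrite -(ger0_norm s0) -sqrtr_sqr ler_wsqrtr// sqrrD.
rewrite /quat_modulus !sqr_sqrtr ?quat_sqn_ge0// -sqrtrM ?quat_sqn_ge0//.
pose d := qre p * qre q + qi p * qi q + qj p * qj q + qk p * qk q.
have -> : quat_sqn (p + q) = quat_sqn p + d *+ 2 + quat_sqn q.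
  by rewrite /quat_sqn /d /=; ring.
rewrite lerD2r lerD2l lerMn2r /=.
apply: (le_trans (ler_norm d)); rewrite -sqrtr_sqr ler_wsqrtr// -subr_ge0.
have -> : quat_sqn p * quat_sqn q - d ^+ 2 =
    (qre p * qi q - qi p * qre q) ^+ 2 + (qre p * qj q - qj p * qre q) ^+ 2 +
    (qre p * qk q - qk p * qre q) ^+ 2 + (qi p * qj q - qj p * qi q) ^+ 2 +
    (qi p * qk q - qk p * qi q) ^+ 2 + (qj p * qk q - qk p * qj q) ^+ 2.
  by rewrite /quat_sqn /d; ring.
by rewrite !addr_ge0// sqr_ge0.
Qed.

Lemma quat_modulusZ (R : realType) (a : R) (p : quaternion R) :
  quat_modulus (a *: p) = `|a| * quat_modulus p.
Proof.
rewrite /quat_modulus -sqrtr_sqr -sqrtrM ?sqr_ge0//; congr Num.sqrt.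
by rewrite /quat_sqn /=; ring.
Qed.

Lemma quat_modulus0_eq0 (R : realType) (p : quaternion R) :
  quat_modulus p = 0 -> p = 0.
Proof.
move=> /eqP; rewrite sqrtr_eq0 /quat_sqn => p0.
have [a0 b0 c0 d0] : [/\ 0 <= qre p ^+ 2, 0 <= qi p ^+ 2,
    0 <= qj p ^+ 2 & 0 <= qk p ^+ 2] by split; exact: sqr_ge0.
by apply: quat_ext => /=; apply/eqP; rewrite -sqrf_eq0; apply/eqP; lra.
Qed.

(* From here on `|q| is the modulus of q, and the topology and the notion of
   real differentiability on the quaternions are those given by it. *)
HB.instance Definition _ (R : realType) :=
  Lmodule_isNormed.Build R (quaternion R)
    (@quat_modulusD R) (@quat_modulusZ R) (@quat_modulus0_eq0 R).

Definition imag_units (R : realType) : set (quaternion R) :=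
  [set I | I ^+ 2 = -1].

Definition qball (R : realType) (r : R) : set (quaternion R) :=
  [set q | `|q| < r].

Definition slice (R : realType) (I : quaternion R) (z : R * R) : quaternion R :=
  z.1 *: 1 + z.2 *: I.

(* The slice of the ball, in the real coordinates (x, y) of x + y I. *)
Definition slice_ball (R : realType) (r : R) (I : quaternion R) : set (R * R) :=
  slice I @^-1` qball r.

(* A function on the ball of radius r is represented by a total function, of
   which only the values on that (open) ball matter. *)
Definition slice_regular (R : realType) (r : R)
    (f : quaternion R -> quaternion R) : Prop :=
  (forall q, qball r q -> differentiable f q) /\
  (forall I, imag_units I -> forall z, slice_ball r I z ->
    let fI : R * R -> quaternion R := f \o slice I in
    [/\ derivable fI z (1, 0) /\ derivable fI z (0, 1),
        {for z, continuous ('D_((1, 0) : R * R) fI)},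
        {for z, continuous ('D_((0, 1) : R * R) fI)} &
        'D_((1, 0) : R * R) fI z + I * 'D_((0, 1) : R * R) fI z = 0]).

Notation lebesgue2 R := (@lebesgue_measure R \x @lebesgue_measure R)%E.

(* The density of the measure lambda^alpha_{I,r} with respect to dx dy, as a
   function of q = x + y I. *)
Definition bergman_weight (R : realType) (alpha r : R) (q : quaternion R) : R :=
  alpha / (pi * r ^+ 2) * (1 - `|q| ^+ 2 / r ^+ 2) `^ (alpha - 1).

Definition bergman (R : realType) (alpha r : R) (I : quaternion R) :
    set (quaternion R -> quaternion R) :=
  [set f | slice_regular r f /\
    (lebesgue2 R).-integrable (slice_ball r I)
      (fun z => (`|f (slice I z)| ^+ 2 *
                 bergman_weight alpha r (slice I z))%:E)].

Definition qintegral (R : realType) (D : set (R * R))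
    (h : R * R -> quaternion R) : quaternion R :=
  Quat (\int[lebesgue2 R]_(z in D) qre (h z))
       (\int[lebesgue2 R]_(z in D) qi (h z))
       (\int[lebesgue2 R]_(z in D) qj (h z))
       (\int[lebesgue2 R]_(z in D) qk (h z)).

Definition bergman_dot (R : realType) (alpha r : R) (I : quaternion R)
    (f g : quaternion R -> quaternion R) : quaternion R :=
  qintegral (slice_ball r I) (fun z =>
    bergman_weight alpha r (slice I z) *:
      (qconj (f (slice I z)) * g (slice I z))).

(* The scalar product of f with itself is a real quaternion, because
   conj(f) f = |f|^2; qre only changes its type to R. *)
Definition bergman_norm (R : realType) (alpha r : R) (I : quaternion R)
    (f : quaternion R -> quaternion R) : R :=
  Num.sqrt (qre (bergman_dot alpha r I f f)).

Definition right_span (R : realType) (e : nat -> quaternion R -> quaternion R) :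
    set (quaternion R -> quaternion R) :=
  [set g | exists (n : nat) (c : nat -> quaternion R),
    g = fun q => \sum_(k < n) e k q * c k].

Definition bergman_orthogonal_basis (R : realType) (alpha r : R)
    (I : quaternion R) (e : nat -> quaternion R -> quaternion R) : Prop :=
  [/\ forall n, bergman alpha r I (e n),
      forall n, exists2 q, qball r q & e n q <> 0,
      forall m n, m <> n -> bergman_dot alpha r I (e m) (e n) = 0 &
      forall f, bergman alpha r I f -> forall eps, 0 < eps ->
        exists2 g, right_span e g &
          bergman_norm alpha r I (fun q => f q - g q) < eps].

Definition monomial (R : realType) (n : nat) (q : quaternion R) :
    quaternion R := q ^+ n.

(* Euler's integral; only used at positive arguments. *)
Definition Gamma (R : realType) (a : R) : R :=
  \int[@lebesgue_measure R]_(t in `]0, +oo[) (t `^ (a - 1) * expR (- t)).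

(* Main.v *)
From HB Require Import structures.
Require Import Defs.
From mathcomp Require Import all_boot all_order all_algebra.
From mathcomp Require Import all_classical all_reals all_analysis.
From mathcomp Require Import measurable_realfun unstable.
From mathcomp Require Import ring lra.

(** The scalar product lives on one slice, where the quaternionic product is the
complex one, so the statement is about functions of a complex variable with
values in the left complex vector space of quaternions.

Orthogonality comes from symmetry. The measure is invariant under rotations
([mu2_preserving_rotation]: a rotation is a product of shears, and shears
preserve the plane Lebesgue measure), and a suitable rotation multiplies the
product of two distinct powers by an imaginary unit; applied twice, it reverses
the sign of the integral ([herm_orthogonal]). This works on every disc centred
at the origin, which is what the density argument needs.

For the norms, the area of a disc is proportional to its squared radius, so the
squared radius carries the plane measure to [pi] times the Lebesgue measure of
the half-line ([integral_sqnorm2]). What remains is the integral of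
[t ^+ n * (1 - t / r ^+ 2) `^ (alpha - 1)] over [0, r ^+ 2[, computed by a
recursion in [n] ([radial_integralS]) that matches the functional equation of
the Gamma function ([GammaS], [integral_moment]).

For density, a slice regular function [f] has a power series on the slice.
Cauchy's formula holds because the integral of [f] against the Cauchy kernel
does not change when the circle is contracted onto the point
([homotopy_integral], [cauchy_circle]); expanding the kernel in a geometric
series gives partial sums that converge uniformly on smaller discs
([power_series_expansion]). There the partial sum [P] is orthogonal to [f - P],
so the mass of [f] is the sum of the masses of [P] and [f - P]
([spoly_pythagoras]), and by monotone convergence this remains true on the whole
disc. If a smaller disc carries all but [e] of the mass of [f], and [P] is so
long that [f - P] has mass at most [e] on that disc, then [P] has mass at least
that of [f] minus [2 * e], and [f - P] has mass at most [2 * e]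
([spoly_mean_approximation]). *)

Set Implicit Arguments.
Unset Strict Implicit.
Unset Printing Implicit Defensive.

Import Order.TTheory GRing.Theory Num.Theory.
Import numFieldNormedType.Exports.

Local Open Scope classical_set_scope.
Local Open Scope ring_scope.

(** * Quaternion algebra *)

Section quaternion_algebra.
Context {R : realType}.
Implicit Types (p q I : quaternion R) (z : R * R) (a b : R).

Lemma qreD p q : qre (p + q) = qre p + qre q. Proof. by []. Qed.

Lemma qreN p : qre (- p) = - qre p. Proof. by []. Qed.

Lemma qreB p q : qre (p - q) = qre p - qre q. Proof. by []. Qed.

Lemma qreZ a p : qre (a *: p) = a * qre p. Proof. by []. Qed.

Lemma qre_sum n (h : nat -> quaternion R) :
  qre (\sum_(k < n) h k) = \sum_(k < n) qre (h k).
Proof. by elim: n => [|n IH]; rewrite ?big_ord0// !big_ord_recr/= -IH. Qed.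

Lemma qreC p q : qre (p * q) = qre (q * p).
Proof. by rewrite /=; ring. Qed.

Lemma norm_quatE q : `|q| = Num.sqrt (quat_sqn q).
Proof. by []. Qed.

Lemma sqr_norm_quat q : `|q| ^+ 2 = quat_sqn q.
Proof. by rewrite norm_quatE sqr_sqrtr// quat_sqn_ge0. Qed.

Lemma norm_quatM p q : `|p * q| = `|p| * `|q|.
Proof.
rewrite !norm_quatE -sqrtrM ?quat_sqn_ge0//; congr Num.sqrt.
by rewrite /quat_sqn /=; ring.
Qed.

Lemma norm_quat1 : `|1 : quaternion R| = 1.
Proof. by rewrite norm_quatE /quat_sqn/= !expr0n/= !addr0 expr1n sqrtr1. Qed.

Lemma norm_quatX q n : `|q ^+ n| = `|q| ^+ n.
Proof.
by elim: n => [|n IH]; rewrite ?expr0 ?norm_quat1// !exprS norm_quatM IH.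
Qed.

Lemma norm_qconj q : `|qconj q| = `|q|.
Proof. by rewrite !norm_quatE /quat_sqn/= !sqrrN. Qed.

Lemma qconjM p q : qconj (p * q) = qconj q * qconj p.
Proof. by apply: quat_ext => /=; ring. Qed.

Lemma mul_qconj q : q * qconj q = (`|q| ^+ 2) *: 1.
Proof. by rewrite sqr_norm_quat; apply: quat_ext; rewrite /quat_sqn/=; ring. Qed.

Lemma mulqconj q : qconj q * q = (`|q| ^+ 2) *: 1.
Proof. by rewrite sqr_norm_quat; apply: quat_ext; rewrite /quat_sqn/=; ring. Qed.

Lemma qre_qconjM q : qre (qconj q * q) = `|q| ^+ 2.
Proof. by rewrite mulqconj /= mulr1. Qed.

Lemma sqr_norm_quatD p q :
  `|p + q| ^+ 2 = `|p| ^+ 2 + `|q| ^+ 2 + 2 * qre (qconj p * q).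
Proof. by rewrite !sqr_norm_quat /quat_sqn/=; ring. Qed.

Lemma le_qre_norm q : `|qre q| <= `|q|.
Proof.
rewrite norm_quatE -sqrtr_sqr ler_wsqrtr// /quat_sqn -!addrA lerDl.
by rewrite !addr_ge0// sqr_ge0.
Qed.

(** The other three coordinates are real parts of multiples, so that a
statement on [qre (p * q)] for every [p] is a statement on [q]. *)
Lemma qi_qre q : qi q = qre (Quat 0 (-1) 0 0 * q).
Proof. by rewrite /=; ring. Qed.

Lemma qj_qre q : qj q = qre (Quat 0 0 (-1) 0 * q).
Proof. by rewrite /=; ring. Qed.

Lemma qk_qre q : qk q = qre (Quat 0 0 0 (-1) * q).
Proof. by rewrite /=; ring. Qed.

(** A bound tested against [p = qconj q], where [qre (p * q)] is [`|q| ^+ 2]. *)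
Lemma quat_qre_le q c : 0 <= c -> (forall p, qre (p * q) <= `|p| * c) ->
  `|q| <= c.
Proof.
move=> c0 /(_ (qconj q)); rewrite qre_qconjM norm_qconj expr2.
have [->|q0] := eqVneq q 0; first by rewrite normr0.
by rewrite ler_pM2l// normr_gt0.
Qed.

Definition qinv q : quaternion R := (`|q| ^+ 2)^-1 *: qconj q.

Lemma mulqV q : q != 0 -> q * qinv q = 1.
Proof.
move=> q0; rewrite /qinv -scalerAr mul_qconj scalerA mulVf ?scale1r//.
by rewrite expf_neq0// normr_eq0.
Qed.

Lemma mulVq q : q != 0 -> qinv q * q = 1.
Proof.
move=> q0; rewrite /qinv -scalerAl mulqconj scalerA mulVf ?scale1r//.
by rewrite expf_neq0// normr_eq0.
Qed.

Lemma norm_qinv q : `|qinv q| = `|q|^-1.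
Proof.
have [->|q0] := eqVneq q 0.
  by rewrite /qinv normr0 expr0n/= invr0 scale0r normr0.
rewrite /qinv normrZ norm_qconj ger0_norm ?invr_ge0 ?sqr_ge0// expr2 invfM.
by rewrite -mulrA mulVf ?mulr1// normr_eq0.
Qed.

(** The imaginary coordinates of [I * I] are twice the product of the real
part by those of [I]; if the real part were not zero, [I] would be real and
its square nonnegative. *)
Lemma imag_unitP I : imag_units I -> qre I = 0 /\ quat_sqn I = 1.
Proof.
rewrite /imag_units/= expr2; case: I => a b c d.
move/(congr1 (fun s => (qre s, qi s, qj s, qk s))) => /= -[ea eb ec ed].
have b0 : a * b = 0 by lra.
have c0 : a * c = 0 by lra.
have d0 : a * d = 0 by lra.
suff a0 : a = 0 by split => //; rewrite /quat_sqn/=; nra.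
apply/eqP/negPn/negP => a0.
move: b0 c0 d0 => /eqP; rewrite mulf_eq0 (negbTE a0)/= => /eqP b0.
move=> /eqP; rewrite mulf_eq0 (negbTE a0)/= => /eqP c0.
move=> /eqP; rewrite mulf_eq0 (negbTE a0)/= => /eqP d0.
by have := sqr_ge0 a; rewrite expr2; subst; lra.
Qed.

End quaternion_algebra.

(** On the plane of an imaginary unit the quaternionic product is commutative:
it is the product [cmul] of complex numbers in real coordinates. *)
Section slice_plane.
Context {R : realType} (I : quaternion R) (HI : imag_units I).
Implicit Types (p q : quaternion R) (z w : R * R) (t : R).

Definition sqnorm2 z : R := z.1 ^+ 2 + z.2 ^+ 2.

Definition cmul z w : R * R := (z.1 * w.1 - z.2 * w.2, z.1 * w.2 + z.2 * w.1).

Definition cis t : R * R := (cos t, sin t).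

Lemma imag_unit_sqr : I * I = -1.
Proof. by have := HI; rewrite /imag_units/= expr2. Qed.

Lemma slice_scale t z : slice I (t *: z) = t *: slice I z.
Proof. by rewrite /slice scalerDr !scalerA. Qed.

Lemma sliceD z w : slice I (z + w) = slice I z + slice I w.
Proof. by rewrite /slice !scalerDl addrACA. Qed.

Lemma sliceB z w : slice I (z - w) = slice I z - slice I w.
Proof. by rewrite -scaleN1r sliceD slice_scale scaleN1r. Qed.

Lemma sliceM z w : slice I z * slice I w = slice I (cmul z w).
Proof.
rewrite /slice/cmul/= mulrDl !mulrDr -!scalerAl -!scalerAr !mul1r mulr1.
rewrite imag_unit_sqr !scalerA scalerBl scalerDl scalerN.
by rewrite [X in _ + X]addrC addrACA.
Qed.

Lemma cmulC z w : cmul z w = cmul w z.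
Proof. by rewrite /cmul; congr (_, _); ring. Qed.

Lemma slice_comm z w : slice I z * slice I w = slice I w * slice I z.
Proof. by rewrite !sliceM cmulC. Qed.

Lemma slice_imag : slice I (0, 1) = I.
Proof. by rewrite /slice/= scale0r add0r scale1r. Qed.

Lemma slice_real t : slice I (t, 0) = t *: 1.
Proof. by rewrite /slice/= scale0r addr0. Qed.

Lemma sqnorm2_ge0 z : 0 <= sqnorm2 z.
Proof. by rewrite addr_ge0// sqr_ge0. Qed.

Lemma sqr_norm_slice z : `|slice I z| ^+ 2 = sqnorm2 z.
Proof.
have [I0 I1] := imag_unitP HI; rewrite sqr_norm_quat.
rewrite -[RHS]addr0 -[X in _ = _ + X](mulr0 (z.2 ^+ 2)) -(subrr (quat_sqn I)).
by rewrite {2}I1 /sqnorm2 /quat_sqn/= I0; ring.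
Qed.

Lemma norm_slice z : `|slice I z| = Num.sqrt (sqnorm2 z).
Proof. by rewrite -sqr_norm_slice sqrtr_sqr normr_id. Qed.

Lemma norm_slice_lt z t : 0 <= t -> (`|slice I z| < t) = (sqnorm2 z < t ^+ 2).
Proof. by move=> t0; rewrite -sqr_norm_slice ltr_pXn2r// nnegrE. Qed.

Lemma slice_ballE t : 0 < t ->
  slice_ball t I = [set z | sqnorm2 z < t ^+ 2].
Proof.
move=> t0; rewrite /slice_ball/qball.
by apply/seteqP; split => z /=; rewrite norm_slice_lt// ltW.
Qed.

Lemma sqnorm2_cis t : sqnorm2 (cis t) = 1.
Proof. by rewrite /sqnorm2/= cos2Dsin2. Qed.

Lemma norm_slice_cis t : `|slice I (cis t)| = 1.
Proof. by rewrite norm_slice sqnorm2_cis sqrtr1. Qed.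

Lemma slice_cisX t n : slice I (cis t) ^+ n = slice I (cis (n%:R * t)).
Proof.
elim: n => [|n IH].
  by rewrite expr0 mul0r /cis cos0 sin0 slice_real scale1r.
rewrite exprS IH sliceM -natr1 mulrDl mul1r /cmul/cis/= cosD sinD.
by congr (slice I (_, _)); ring.
Qed.

End slice_plane.

(** * Calculus of quaternion-valued functions *)

Section quaternion_calculus.
Context {R : realType}.
Implicit Types (p q : quaternion R).

Let qI : quaternion R := Quat 0 1 0 0.
Let qJ : quaternion R := Quat 0 0 1 0.
Let qK : quaternion R := Quat 0 0 0 1.

Lemma quat_coordE q :
  q = qre q *: 1 + qi q *: qI + qj q *: qJ + qk q *: qK.
Proof. by apply: quat_ext => /=; ring. Qed.

Definition qcoord p q : R := qre (p * q).

Lemma qcoord_is_linear p : linear (qcoord p : quaternion R -> R^o).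
Proof. by move=> a q s; rewrite /qcoord mulrDr -scalerAr. Qed.

HB.instance Definition _ p := GRing.isLinear.Build R (quaternion R) R^o *:%R
  (qcoord p) (qcoord_is_linear p).

Lemma qcoordB p q s : qcoord p (q - s) = qcoord p q - qcoord p s.
Proof. by rewrite /qcoord mulrBr. Qed.

Lemma qcoordZ p a q : qcoord p (a *: q) = a * qcoord p q.
Proof. by rewrite /qcoord -scalerAr. Qed.

Lemma le_qcoord_norm p q : `|qcoord p q| <= `|p| * `|q|.
Proof. by rewrite (le_trans (le_qre_norm _))// norm_quatM. Qed.

Lemma continuous_qcoord p : continuous (qcoord p).
Proof.
apply/(linear_bounded_continuous (qcoord p : {linear _ -> R^o})).
apply/linear_boundedP.
exists `|p|; split; first exact: normr_real.
move=> M pM q; rewrite (le_trans (le_qcoord_norm _ _))//.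
by rewrite ler_wpM2r// ltW.
Qed.

Lemma differentiable_qcoord p q : differentiable (qcoord p : _ -> R^o) q.
Proof. by apply: linear_differentiable; exact: continuous_qcoord. Qed.

Lemma qre_qcoord : @qre R = qcoord (1 : quaternion R).
Proof. by apply/funext => q; rewrite /qcoord mul1r. Qed.

Lemma qi_qcoord : @qi R = qcoord (Quat 0 (-1) 0 0 : quaternion R).
Proof. by apply/funext => q; rewrite qi_qre. Qed.

Lemma qj_qcoord : @qj R = qcoord (Quat 0 0 (-1) 0 : quaternion R).
Proof. by apply/funext => q; rewrite qj_qre. Qed.

Lemma qk_qcoord : @qk R = qcoord (Quat 0 0 0 (-1) : quaternion R).
Proof. by apply/funext => q; rewrite qk_qre. Qed.

Section convergence.
Context {T : Type} {F : set_system T} {FF : Filter F}.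
Implicit Types u v : T -> quaternion R.

Lemma cvg_qcoord p u q :
  u @ F --> q -> (fun x => qcoord p (u x)) @ F --> qcoord p q.
Proof. by move=> uq; apply: cvg_comp uq _; exact: continuous_qcoord. Qed.

Lemma cvg_quat u q :
  (fun x => qre (u x)) @ F --> qre q -> (fun x => qi (u x)) @ F --> qi q ->
  (fun x => qj (u x)) @ F --> qj q -> (fun x => qk (u x)) @ F --> qk q ->
  u @ F --> q.
Proof.
move=> h1 h2 h3 h4; rewrite [q]quat_coordE.
rewrite (_ : u = fun x => qre (u x) *: 1 + qi (u x) *: qI + qj (u x) *: qJ +
    qk (u x) *: qK); last by apply/funext => y; exact: quat_coordE.
by do !apply: cvgD; apply: cvgZr_tmp.
Qed.

Lemma cvg_quatM u v p q :
  u @ F --> p -> v @ F --> q -> (fun x => u x * v x) @ F --> p * q.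
Proof.
move=> up vq.
have [h1 h2 h3 h4] : [/\ (fun x => qre (u x)) @ F --> qre p,
    (fun x => qi (u x)) @ F --> qi p, (fun x => qj (u x)) @ F --> qj p &
    (fun x => qk (u x)) @ F --> qk p].
  by rewrite qre_qcoord qi_qcoord qj_qcoord qk_qcoord; split; exact: cvg_qcoord.
have [k1 k2 k3 k4] : [/\ (fun x => qre (v x)) @ F --> qre q,
    (fun x => qi (v x)) @ F --> qi q, (fun x => qj (v x)) @ F --> qj q &
    (fun x => qk (v x)) @ F --> qk q].
  by rewrite qre_qcoord qi_qcoord qj_qcoord qk_qcoord; split; exact: cvg_qcoord.
apply: cvg_quat.
- exact: (cvgB (cvgB (cvgB (cvgM h1 k1) (cvgM h2 k2)) (cvgM h3 k3)) (cvgM h4 k4)).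
- exact: (cvgB (cvgD (cvgD (cvgM h1 k2) (cvgM h2 k1)) (cvgM h3 k4)) (cvgM h4 k3)).
- exact: (cvgD (cvgD (cvgB (cvgM h1 k3) (cvgM h2 k4)) (cvgM h3 k1)) (cvgM h4 k2)).
- exact: (cvgD (cvgB (cvgD (cvgM h1 k4) (cvgM h2 k3)) (cvgM h3 k2)) (cvgM h4 k1)).
Qed.

Lemma cvg_qcoord2 u v p q : u @ F --> p -> v @ F --> q ->
  (fun x => qcoord (u x) (v x)) @ F --> qcoord p q.
Proof.
move=> up vq; rewrite /qcoord qre_qcoord; apply: cvg_qcoord.
exact: cvg_quatM.
Qed.

Lemma cvg_qconj u p : u @ F --> p -> (fun x => qconj (u x)) @ F --> qconj p.
Proof.
move=> up; apply: cvg_quat => /=; last 3 first.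
- by apply: cvgN; rewrite qi_qcoord; exact: cvg_qcoord.
- by apply: cvgN; rewrite qj_qcoord; exact: cvg_qcoord.
- by apply: cvgN; rewrite qk_qcoord; exact: cvg_qcoord.
by rewrite qre_qcoord; exact: cvg_qcoord.
Qed.

Lemma cvg_qinv u p : p != 0 -> u @ F --> p -> (fun x => qinv (u x)) @ F --> qinv p.
Proof.
move=> p0 up; apply: cvgZ; last exact: cvg_qconj.
apply: cvgV; first by rewrite expf_neq0// normr_eq0.
by apply: cvgM; exact: cvg_norm.
Qed.

Lemma cvg_quatX u p n : u @ F --> p -> (fun x => u x ^+ n) @ F --> p ^+ n.
Proof.
move=> up; elim: n => [|n IH]; first exact: cvg_cst.
by under eq_fun do rewrite exprS; rewrite exprS; exact: cvg_quatM.
Qed.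

End convergence.

Section derivation.
Context {V : normedModType R}.
Implicit Types (u w : V -> quaternion R) (x v : V).

Lemma is_derive_cvgP {W : normedModType R} (f : V -> W) x v (df : W) :
  is_derive x v f df <->
  (fun h : R => h^-1 *: (f (h *: v + x) - f x)) @ 0^' --> df.
Proof.
split=> [[fxv <-]|fdf]; first exact: fxv.
by split; [apply/cvg_ex; exists df | exact/cvg_lim].
Qed.

Lemma is_derive_qcoord p u x v du : is_derive x v u du ->
  is_derive x v (fun y => qcoord p (u y)) (qcoord p du).
Proof.
move=> /is_derive_cvgP udu; apply/is_derive_cvgP.
rewrite (_ : (fun h => _) = fun h : R =>
    qcoord p (h^-1 *: (u (h *: v + x) - u x))); first exact: cvg_qcoord.
by apply/funext => h; rewrite qcoordZ qcoordB.
Qed.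

Lemma is_derive_quat u x v du :
  is_derive x v (fun y => qre (u y)) (qre du) ->
  is_derive x v (fun y => qi (u y)) (qi du) ->
  is_derive x v (fun y => qj (u y)) (qj du) ->
  is_derive x v (fun y => qk (u y)) (qk du) -> is_derive x v u du.
Proof.
move=> /is_derive_cvgP h1 /is_derive_cvgP h2 /is_derive_cvgP h3.
by move=> /is_derive_cvgP h4; apply/is_derive_cvgP/cvg_quat.
Qed.

(** The Leibniz rule, with the factors kept in order. *)
Lemma is_derive_quatM u w x v du dw : is_derive x v u du ->
  is_derive x v w dw ->
  is_derive x v (fun y => u y * w y) (du * w x + u x * dw).
Proof.
move=> udu wdw.
have := is_derive_qcoord 1 udu; have := is_derive_qcoord 1 wdw.
have := is_derive_qcoord (Quat 0 (-1) 0 0) udu.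
have := is_derive_qcoord (Quat 0 (-1) 0 0) wdw.
have := is_derive_qcoord (Quat 0 0 (-1) 0) udu.
have := is_derive_qcoord (Quat 0 0 (-1) 0) wdw.
have := is_derive_qcoord (Quat 0 0 0 (-1)) udu.
have := is_derive_qcoord (Quat 0 0 0 (-1)) wdw.
rewrite -qre_qcoord -qi_qcoord -qj_qcoord -qk_qcoord => *.
apply: is_derive_quat; apply: is_derive_eq; rewrite /= /GRing.scale/=; ring.
Qed.

Lemma differentiable_quat u x :
  differentiable (fun y => qre (u y) : R^o) x ->
  differentiable (fun y => qi (u y) : R^o) x ->
  differentiable (fun y => qj (u y) : R^o) x ->
  differentiable (fun y => qk (u y) : R^o) x -> differentiable u x.
Proof.
move=> h1 h2 h3 h4; rewrite (_ : u = fun x => qre (u x) *: 1 + qi (u x) *: qI + qj (u x) *: qJ +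
    qk (u x) *: qK); last by apply/funext => y; exact: quat_coordE.
by do !apply: differentiableD; apply: differentiableZl.
Qed.

Lemma differentiable_quatM u w x : differentiable u x -> differentiable w x ->
  differentiable (fun y => u y * w y) x.
Proof.
move=> du dw.
have C (f : V -> quaternion R) p : differentiable f x ->
    differentiable (fun y => qcoord p (f y) : R^o) x.
  by move=> df; apply: differentiable_comp => //; exact: differentiable_qcoord.
have [h1 h2 h3 h4] : [/\ differentiable (fun y => qre (u y) : R^o) x,
    differentiable (fun y => qi (u y) : R^o) x,
    differentiable (fun y => qj (u y) : R^o) x &
    differentiable (fun y => qk (u y) : R^o) x].
  by rewrite qre_qcoord qi_qcoord qj_qcoord qk_qcoord; split; exact: C.
have [k1 k2 k3 k4] : [/\ differentiable (fun y => qre (w y) : R^o) x,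
    differentiable (fun y => qi (w y) : R^o) x,
    differentiable (fun y => qj (w y) : R^o) x &
    differentiable (fun y => qk (w y) : R^o) x].
  by rewrite qre_qcoord qi_qcoord qj_qcoord qk_qcoord; split; exact: C.
apply: differentiable_quat.
- exact: (differentiableB (differentiableB
    (differentiableB (differentiableM h1 k1) (differentiableM h2 k2))
    (differentiableM h3 k3)) (differentiableM h4 k4)).
- exact: (differentiableB (differentiableD
    (differentiableD (differentiableM h1 k2) (differentiableM h2 k1))
    (differentiableM h3 k4)) (differentiableM h4 k3)).
- exact: (differentiableD (differentiableD
    (differentiableB (differentiableM h1 k3) (differentiableM h2 k4))
    (differentiableM h3 k1)) (differentiableM h4 k2)).
- exact: (differentiableD (differentiableB
    (differentiableD (differentiableM h1 k4) (differentiableM h2 k3))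
    (differentiableM h3 k2)) (differentiableM h4 k1)).
Qed.

End derivation.

End quaternion_calculus.

(** * Plane Lebesgue measure *)

(** The plane, with the measurable structure that carries [lebesgue2]. *)
Notation plane R := (measurableTypeR R * measurableTypeR R)%type.

Section plane_measurability.
Context {R : realType}.

Lemma open_measurable2 (U : set (R * R)) : open U ->
  measurable (U : set (plane R)).
Proof.
move=> oU.
(* countably many squares with rational centres exhaust U *)
pose Q (p q : rat) (n : nat) : set (R * R) :=
  ball (ratr p : R) n.+1%:R^-1 `*` ball (ratr q : R) n.+1%:R^-1.
pose Q' p q n := if `[< Q p q n `<=` U >] then Q p q n else set0.
suff -> : U = \bigcup_p \bigcup_q \bigcup_n Q' p q n.
  apply: bigcupT_measurable_rat => p; apply: bigcupT_measurable_rat => q.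
  apply: bigcupT_measurable => n; rewrite /Q'; case: ifPn => // _.
  by apply: measurableX; apply: open_measurable; exact: ball_open.
apply/seteqP; split=> [[x y] Uxy|z [p _ [q _ [n _]]]]; last first.
  by rewrite /Q'; case: ifPn => // /asboolP; exact.
have /nbhs_ballP[e /= e0 eU] := oU _ Uxy.
pose n := Num.truncn (2 / e).
have n0 : 0 < n.+1%:R^-1 :> R by rewrite invr_gt0.
have ne : 2 * n.+1%:R^-1 <= e.
  by rewrite ler_pdivrMr// mulrC -ler_pdivrMr// ltW// truncnS_gt.
have near_rat (a : R) : exists p : rat, `|ratr p - a| < n.+1%:R^-1.
  have [|p] := @rat_in_itvoo R (a - n.+1%:R^-1) (a + n.+1%:R^-1).
    by rewrite ltrD2l gt0_cp.
  rewrite in_itv/= => /andP[ap pa]; exists p; rewrite ltr_norml.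
  by rewrite ltrBlDl pa andbT ltrBrDl.
have [p px] := near_rat x; have [q qy] := near_rat y.
exists p => //; exists q => //; exists n => //; rewrite /Q' ifT.
  by split => /=; rewrite /ball/=.
apply/asboolP => -[x' y'] [/= px' qy']; apply: eU.
rewrite /ball/= in px' qy' *; split; rewrite /ball/=.
  by move: n0 ne px px'; set d := _^-1; rewrite !ltr_norml => *; lra.
by move: n0 ne qy qy'; set d := _^-1; rewrite !ltr_norml => *; lra.
Qed.

(** Continuity is required at the points of [D] only, because a function on a
ball is given by a total function with arbitrary values outside. *)
Lemma continuous_at_measurable (D : set (plane R)) (g : R * R -> R) :
  measurable D -> (forall z, D z -> {for z, continuous g}) ->
  measurable_fun D (g : plane R -> R).
Proof.
move=> mD cg; apply: (measurability _ (RGenOpens.measurableE R)).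
move=> _ [_ [a [b ->] <-]]; set B := (X in g @^-1` X).
suff -> : D `&` g @^-1` B = D `&` (g @^-1` B)°.
  apply: measurableI => //; apply: open_measurable2; exact: open_interior.
apply/seteqP; split=> z [Dz zB]; split => //; last first.
  exact: (@interior_subset _ (g @^-1` B)).
by apply: (cg z Dz); apply: open_nbhs_nbhs; split => //; exact: interval_open.
Qed.

End plane_measurability.

Section plane_isometries.
Context {R : realType}.
Local Notation mu := (@lebesgue_measure R).
Local Notation mu2 := (lebesgue2 R).

Lemma lebesgue_measure_shift (c : R) (A : set R) : measurable A ->
  mu ((fun x => x + c) @^-1` A) = mu A.
Proof.
have mc : measurable_fun setT (fun x : R => x + c : measurableTypeR R).
  exact: measurable_funD.
move=> mA; rewrite -[LHS]/(pushforward mu (fun x : R => x + c : measurableTypeR R) A).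
apply/esym/lebesgue_measure_unique => //= _ [[a b]] _ <-; rewrite /pushforward.
rewrite (_ : _ @^-1` _ = `]a - c, b - c]%classic).
  rewrite !lebesgue_measure_itv/= !lte_fin ltrD2r.
  by case: ifPn => // _; rewrite -!EFinB; congr EFin; ring.
by apply/seteqP; split => x; rewrite /= !in_itv/=; lra.
Qed.

Definition mu2_preserving (T : plane R -> plane R) : Prop :=
  measurable_fun setT T /\ forall A, measurable A -> mu2 (T @^-1` A) = mu2 A.

Lemma mu2_preserving_comp (S T : plane R -> plane R) :
  mu2_preserving S -> mu2_preserving T -> mu2_preserving (S \o T).
Proof.
move=> [mS pS] [mT pT]; split; first exact: measurableT_comp.
move=> A mA; rewrite comp_preimage pT ?pS//.
by rewrite -[X in measurable X]setTI; exact: mS.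
Qed.

Lemma mu2_preserving_swap :
  mu2_preserving (@swap (measurableTypeR R) (measurableTypeR R)).
Proof.
split; first exact: measurable_swap.
move=> A mA; set sw := @swap _ _; rewrite -[LHS]/(pushforward mu2 sw A).
apply: esym; apply: (@product_measure_unique _ _ _ _ _ mu mu
  (pushforward mu2 sw)) => //= [|mf B C mB mC].
  exact: measurable_swap.
rewrite /pushforward (_ : _ @^-1` _ = C `*` B); last first.
  by apply/seteqP; split => -[x y] /= [].
by rewrite product_measure1E// muleC.
Qed.

(** A shear translates every vertical line. *)
Lemma mu2_preserving_shear (c : R) :
  mu2_preserving (fun z => (z.1, z.2 + c * z.1)).
Proof.
have mT : measurable_fun setT (fun z : plane R => (z.1, z.2 + c * z.1) : plane R).
  apply: measurable_fun_pair => //; apply: measurable_funD => //.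
  exact: measurable_funM.
split => // A mA; rewrite /product_measure1/=; apply: eq_integral => x _ /=.
rewrite -[RHS](lebesgue_measure_shift (c * x)); last exact: measurable_xsection.
by congr (mu _); apply/seteqP; split => y; rewrite /xsection/= !inE.
Qed.

Definition rotation (c s : R) (z : R * R) : R * R :=
  (c * z.1 - s * z.2, s * z.1 + c * z.2).

(** A rotation is a product of three shears, the outer ones with the tangent
[s / (1 + c)] of half the angle as coefficient. *)
Lemma mu2_preserving_rotation (c s : R) : c ^+ 2 + s ^+ 2 = 1 -> 0 <= c ->
  mu2_preserving (rotation c s).
Proof.
move=> cs c0; pose t := s / (1 + c).
have c1 : 1 + c != 0 by rewrite gt_eqF// ltr_pwDl.
have hshear : mu2_preserving (fun z => (z.1 + - t * z.2, z.2)).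
  exact: (mu2_preserving_comp mu2_preserving_swap
    (mu2_preserving_comp (mu2_preserving_shear (- t)) mu2_preserving_swap)).
rewrite (_ : rotation c s = (fun z => (z.1 + - t * z.2, z.2)) \o
    ((fun z => (z.1, z.2 + s * z.1)) \o (fun z => (z.1 + - t * z.2, z.2)))).
  do !apply: mu2_preserving_comp => //; exact: mu2_preserving_shear.
have tc : t * (1 + c) = s by rewrite /t mulfVK.
have ts : 1 - t * s = c.
  apply: (mulIf c1); rewrite mulrBl mulrAC tc; lra.
apply/funext => -[x y]; rewrite /rotation/=; congr (_, _).
  transitivity ((1 - t * s) * x - t * (1 + (1 - t * s)) * y); last by ring.
  by rewrite ts tc.
by rewrite -{1}ts; ring.
Qed.

End plane_isometries.

(** * The plane Lebesgue measure in the radial variable *)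

Section radial_measure.
Context {R : realType}.
Local Notation mu := (@lebesgue_measure R).
Local Notation mu2 := (lebesgue2 R).

Lemma FTC_segment (F f : R -> R) (a b : R) : a < b ->
  (forall x, a <= x <= b -> is_derive x 1 F (f x)) ->
  (forall x, a <= x <= b -> {for x, continuous f}) ->
  (\int[mu]_(x in `[a, b]) (f x)%:E)%E = (F b - F a)%:E.
Proof.
move=> ab dF cf; rewrite EFinB; apply: continuous_FTC2 => //.
- apply/continuous_in_subspaceT => x; rewrite inE/= in_itv/= => xab.
  exact: cf.
- have cF x : a <= x <= b -> {for x, continuous F}.
    move=> xab; apply: differentiable_continuous; apply/derivable1_diffP.
    by have [] := dF _ xab.
  split=> [x||].
  + rewrite in_itv/= => /andP[ax xb].
    have xab : a <= x <= b by rewrite !ltW.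
    by have [] := dF x xab.
  + by apply: cvg_at_right_filter; apply: cF; rewrite lexx ltW.
  + by apply: cvg_at_left_filter; apply: cF; rewrite lexx ltW.
- move=> x; rewrite in_itv/= => /andP[ax xb].
  have xab : a <= x <= b by rewrite !ltW.
  by rewrite derive1E; have [] := dF x xab.
Qed.

Lemma is_derive_continuous (F : R -> R) (x df : R) :
  is_derive x 1 F df -> {for x, continuous F}.
Proof.
by move=> [h _]; exact/differentiable_continuous/derivable1_diffP.
Qed.

(** Substitute [a * sin t] for [x]. *)
Lemma integral_half_circle (a : R) : 0 <= a ->
  (\int[mu]_(x in `[(- a)%R, a]) (2 * Num.sqrt (a ^+ 2 - x ^+ 2))%:E)%E =
  (pi * a ^+ 2)%:E.
Proof.
rewrite le_eqVlt => /predU1P[<-|a0].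
  by rewrite oppr0 set_itv1 integral_set1 expr0n/= mulr0.
pose F t := a * sin t.
have dF (t : R) : is_derive t 1 F (a * cos t).
  by apply: is_derive_eq.
have F'E : derive1 F = fun t : R => a * cos t.
  by apply/funext => t; rewrite derive1E; have [] := dF t.
have cF' : continuous (derive1 F).
  rewrite F'E => t; apply: cvgM; [exact: cvg_cst|exact: continuous_cos].
have pi2 : - (pi / 2) < pi / 2 :> R by have := pi_gt0 R; lra.
have FN : F (- (pi / 2)) = - a by rewrite /F sinN sin_pihalf mulrN1.
have FP : F (pi / 2) = a by rewrite /F sin_pihalf mulr1.
rewrite -[X in `[X, _]]FN -[X in `[_, X]]FP.
rewrite (@integration_by_substitution_increasing _ F
  (fun x => 2 * Num.sqrt (a ^+ 2 - x ^+ 2)) (- (pi / 2)) (pi / 2)); last 7 first.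
- exact: ltW.
- move=> x y xp yp xy; by rewrite /F ltr_pM2l// ltr_sin.
- by move=> x _; exact: cF'.
- by apply/cvg_ex; eexists; apply: cvg_at_right_filter; exact: cF'.
- by apply/cvg_ex; eexists; apply: cvg_at_left_filter; exact: cF'.
- split=> [x _||]; first by have [] := dF x.
  + by apply: cvg_at_right_filter; exact: is_derive_continuous (dF _).
  + by apply: cvg_at_left_filter; exact: is_derive_continuous (dF _).
- apply: continuous_subspaceT => x; apply: cvgM; first exact: cvg_cst.
  have c2 : {for x, continuous (fun y : R => a ^+ 2 - y ^+ 2)}.
    by apply: cvgB; [exact: cvg_cst|exact: exprn_continuous].
  exact: (continuous_comp c2 (@sqrt_continuous _ _)).
pose P t := a ^+ 2 * (t + sin t * cos t).
have dP (t : R) : is_derive t 1 P (2 * a ^+ 2 * cos t ^+ 2).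
  apply: is_derive_eq; rewrite /GRing.scale/=.
  by have := sin2cos2 t; rewrite !expr2 => s2; nra.
transitivity (\int[mu]_(x in `[(- (pi / 2))%R, (pi / 2)%R]) (2 * a ^+ 2 * cos x ^+ 2)%:E)%E.
  apply: eq_integral => t /set_mem/=; rewrite in_itv/= => tp; congr EFin.
  change (2 * Num.sqrt (a ^+ 2 - F t ^+ 2) * derive1 F t = 2 * a ^+ 2 * cos t ^+ 2).
  have -> : a ^+ 2 - F t ^+ 2 = (a * cos t) ^+ 2.
    by rewrite /F !exprMn cos2sin2 mulrBr mulr1.
  rewrite sqrtr_sqr ger0_norm ?F'E; first by ring.
  by rewrite mulr_ge0// ?cos_ge0_pihalf// ltW.
rewrite (FTC_segment pi2 (fun x _ => dP x)).
  by rewrite /P cosN cos_pihalf; congr EFin; lra.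
move=> x _; apply: cvgM; first exact: cvg_cst.
by apply: cvgM; exact: continuous_cos.
Qed.

Lemma measurable_sqnorm2 :
  measurable_fun setT (@sqnorm2 R : plane R -> measurableTypeR R).
Proof.
apply: (measurable_funD (f := fun z : plane R => (z.1 : R) ^+ 2)
  (g := fun z : plane R => (z.2 : R) ^+ 2)).
  by apply: measurable_funX; exact: measurable_fst.
by apply: measurable_funX; exact: measurable_snd.
Qed.

(** The vertical sections of a disc are the intervals whose lengths are
integrated in [integral_half_circle]. *)
Lemma measure_disc (t : R) :
  mu2 [set z | sqnorm2 z <= t] = (pi * Num.max t 0)%:E.
Proof.
have [t0|t0] := ltP t 0.
  rewrite (_ : [set z | _] = set0) ?measure0 ?mulr0//.
  apply/seteqP; split => z //=; rewrite leNgt (lt_le_trans t0)//.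
  exact: sqnorm2_ge0.
have tE : Num.sqrt t ^+ 2 = t by rewrite sqr_sqrtr.
rewrite -{2}tE -integral_half_circle ?sqrtr_ge0// tE [RHS]integral_mkcond.
rewrite /product_measure1/=; apply: eq_integral => x _.
rewrite patchE; case: ifPn => [/set_mem|/negP xt] /=.
  rewrite in_itv/= -ler_norml => xt.
  have xt2 : 0 <= t - x ^+ 2.
    by rewrite subr_ge0 -tE -real_normK ?num_real// ler_pXn2r ?nnegrE ?sqrtr_ge0.
  rewrite (_ : xsection _ x =
      `[- Num.sqrt (t - x ^+ 2), Num.sqrt (t - x ^+ 2)]%classic).
    rewrite lebesgue_measure_itv/= lte_fin -EFinB.
    have [_|] := ltP; first by congr EFin; ring.
    have := sqrtr_ge0 (t - x ^+ 2); set s := Num.sqrt _ => *.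
    by have -> : s = 0; [lra|rewrite mulr0].
  apply/seteqP; split => y; rewrite /xsection/= in_itv/= -ler_norml inE/= /sqnorm2/=.
    by rewrite -lerBrDl => yt; rewrite -sqrtr_sqr ler_wsqrtr.
  move=> yt; rewrite -lerBrDl -(sqr_sqrtr xt2) -real_normK ?num_real//.
  by rewrite ler_pXn2r ?nnegrE ?sqrtr_ge0.
rewrite (_ : xsection _ x = set0) ?measure0//.
apply/seteqP; split => y //; rewrite /xsection/= inE/= /sqnorm2/= => xyt.
apply: xt; rewrite inE/= in_itv/= -ler_norml -sqrtr_sqr ler_wsqrtr//.
by rewrite (le_trans _ xyt)// lerDl sqr_ge0.
Qed.

Lemma ray_measure_unique (m : {measure set (measurableTypeR R) -> \bar R})
    (c : R) : 0 < c ->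
  (forall t, m `]-oo, t]%classic = (c * Num.max t 0)%:E) ->
  forall A : set (measurableTypeR R), measurable A -> A `<=` `[0, +oo[ -> m A = (c%:E * mu A)%E.
Proof.
move=> c0 mray A mA A0.
have cV0 : 0 <= c^-1 by rewrite invr_ge0 ltW.
have mneg : measurable (`]-oo, 0[%classic : set (measurableTypeR R)) by [].
(* completing m by the Lebesgue measure on the negative half-line makes it
   proportional to the Lebesgue measure on all intervals *)
pose m' := measure_add (mscale (NngNum cV0) m) (mrestr mu mneg).
have m'E B : m' B = (c^-1%:E * m B + mu (B `&` `]-oo, 0%R[))%E.
  by rewrite /m' measure_addE.
suff muE B : measurable B -> mu B = m' B.
  rewrite muE// m'E.
  rewrite (_ : A `&` _ = set0) ?measure0 ?adde0.
    by rewrite muleA -EFinM divff ?mul1e// gt_eqF.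
  apply/seteqP; split => x //= [/A0/=]; rewrite !in_itv/= andbT => x0.
  by rewrite ltNge x0.
apply: lebesgue_measure_unique => _ [[a b]] _ <- /=.
have [ba|ab] := leP b a.
  by rewrite set_itv_ge ?measure0// bnd_simp -leNgt.
have mab : m `]a, b]%classic = (c * Num.max b 0 - c * Num.max a 0)%:E.
  have := mray b; rewrite (@itv_bndbnd_setU _ _ _ (BRight a)) ?bnd_simp// ?ltW//.
  rewrite measureU//=; last first.
    apply/seteqP; split => x //= []; rewrite !in_itv/= => xa /andP[].
    by rewrite ltNge xa.
  rewrite mray => h; rewrite EFinB -h addeAC subee// add0e//.
rewrite -[RHS]/(m' `]a, b]%classic) m'E mab -EFinM -mulrBr mulKf ?gt_eqF//.
rewrite lebesgue_measure_itv/= lte_fin ab.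
have [a0|a0] := leP 0 a.
  rewrite (_ : _ `&` _ = set0) ?measure0 ?adde0.
    by rewrite !max_l// (le_trans a0)// ltW.
  apply/seteqP; split => x //= []; rewrite !in_itv/= => /andP[ax _] x0.
  by move: (lt_trans (le_lt_trans a0 ax) x0); rewrite ltxx.
have [b0|b0] := leP 0 b.
  rewrite (_ : _ `&` _ = `]a, 0[%classic).
    rewrite lebesgue_measure_itv/= lte_fin a0 -!EFinB -EFinD; congr EFin.
    by ring.
  apply/seteqP; split => x /=; rewrite !in_itv/=.
    by move=> [/andP[-> _] ->].
  by move=> /andP[-> x0]; rewrite x0 (le_trans (ltW x0)).
rewrite setIidl.
  by rewrite lebesgue_measure_itv/= lte_fin ab subr0 add0e.
by move=> x /=; rewrite !in_itv/= => /andP[_ xb]; exact: le_lt_trans b0.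
Qed.

(** Areas of discs grow linearly in the squared radius, so the squared radius
carries the plane measure to a multiple of the Lebesgue measure. *)
Lemma measure_preimage_sqnorm2 (A : set (measurableTypeR R)) :
  measurable A -> A `<=` `[0, +oo[ ->
  mu2 (@sqnorm2 R @^-1` A) = (pi%:E * mu A)%E.
Proof.
move=> mA A0.
rewrite -[LHS]/(pushforward mu2 (@sqnorm2 R : plane R -> measurableTypeR R) A).
apply: ray_measure_unique => //; first exact: measurable_sqnorm2.
  exact: pi_gt0.
move=> ? t; rewrite -measure_disc /pushforward; congr (mu2 _).
Qed.

Lemma integral_sqnorm2 (g : R -> R) (D : set (measurableTypeR R)) :
  measurable D -> D `<=` `[0, +oo[ ->
  measurable_fun D (g : measurableTypeR R -> R) -> (forall t, D t -> 0 <= g t) ->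
  (\int[mu2]_(z in @sqnorm2 R @^-1` D) (g (sqnorm2 z))%:E =
   pi%:E * \int[mu]_(t in D) (g t)%:E)%E.
Proof.
move=> mD D0 mg g0.
have mg' : measurable_fun D (EFin \o g : measurableTypeR R -> \bar R).
  exact/measurable_EFinP.
have g0' t : D t -> (0 <= (EFin \o g) t)%E by move=> /g0; rewrite lee_fin.
transitivity (\int[pushforward mu2
    (@sqnorm2 R : plane R -> measurableTypeR R)]_(t in D) (EFin \o g) t)%E.
  by rewrite ge0_integral_pushforward//; [exact: measurable_sqnorm2|
    move=> t /set_mem/g0'].
have pi0 : 0 <= (pi : R) := pi_ge0 R.
rewrite -(ge0_integral_mscale mu mD (NngNum pi0) mg')//.
apply: eq_measure_integral => [|? B mB BD]; first exact: measurable_sqnorm2.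
rewrite -[RHS]/(pi%:E * mu B)%E -measure_preimage_sqnorm2//.
by move=> t /BD; exact: D0.
Qed.

End radial_measure.

(** * The radial integrals and Euler's integral *)

Section euler_integrals.
Context {R : realType}.
Local Notation mu := (@lebesgue_measure R).

(** For [a < 1] the weight [(1 - t / c) `^ (a - 1)] is unbounded at [c]: its
integrals are limits of integrals over the segments that end at these points. *)
Definition inner_end (c : R) (k : nat) : R := c - c * k.+2%:R^-1.

Lemma inner_end_itv (c : R) k : 0 < c -> 0 < inner_end c k < c.
Proof.
move=> c0; rewrite /inner_end subr_gt0 ltrBlDr ltrDl.
have k0 : 0 < k.+2%:R^-1 :> R by rewrite invr_gt0.
rewrite mulr_gt0// andbT -[ltRHS]mulr1 ltr_pM2l//.
by rewrite invf_lt1// ltr1n.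
Qed.

Lemma cvg_inner_end (c : R) : inner_end c k @[k --> \oo] --> c.
Proof.
rewrite -[X in _ --> X]subr0; apply: cvgB; first exact: cvg_cst.
rewrite -[X in _ --> X](mulr0 c); apply: cvgM; first exact: cvg_cst.
by have := @cvg_harmonic R; rewrite -(cvg_shiftS _ (nbhs (0 : R))).
Qed.

Lemma cvg_inner_powR (c a : R) : 0 < c -> 0 < a ->
  (1 - inner_end c k / c) `^ a @[k --> \oo] --> (0 : R).
Proof.
move=> c0 a0; move/cvg_at_rightP : (powR_cvg0 a0); apply; split => [k|].
  by rewrite subr_gt0 ltr_pdivrMr// mul1r; have /andP[] := inner_end_itv k c0.
rewrite -[X in _ --> X](subrr 1); apply: cvgB; first exact: cvg_cst.
rewrite -(@divff _ c) ?gt_eqF//; apply: cvgM; last exact: cvg_cst.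
exact: cvg_inner_end.
Qed.

Lemma bigcup_inner_end (c : R) : 0 < c ->
  `[0, c[%classic = \bigcup_k `[0, inner_end c k]%classic.
Proof.
move=> c0; apply/seteqP; split => [x|x [k _]]; rewrite /= !in_itv/=; last first.
  move=> /andP[-> /le_lt_trans]; apply.
  by have /andP[] := inner_end_itv k c0.
move=> /andP[x0 xc]; have := @cvg_inner_end c => /cvgrPdist_lt.
move=> /(_ (c - x)); rewrite subr_gt0 => /(_ xc)[N _ /(_ N)/= /(_ (leqnn _))].
move=> Nx; exists N => //=; rewrite in_itv/= x0/=.
by move: Nx; rewrite gtr0_norm ?subr_gt0; [lra|have /andP[] := inner_end_itv N c0].
Qed.

Lemma cvg_integral_inner (c : R) (h : R -> R) : 0 < c ->
  measurable_fun `[0, c[ h -> (forall t, 0 <= t < c -> 0 <= h t) ->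
  (\int[mu]_(t in `[0%R, inner_end c k]) (h t)%:E @[k --> \oo] -->
   \int[mu]_(t in `[0%R, c[) (h t)%:E)%E.
Proof.
move=> c0 mh h0.
have sub k : `[0, inner_end c k] `<=` `[0, c[.
  by move=> x xk; rewrite bigcup_inner_end//; exists k.
rewrite bigcup_inner_end//; apply: ge0_nondecreasing_set_cvg_integral => //.
- move=> m n mn; apply/subsetPset => x; rewrite /= !in_itv/= => /andP[-> xm]/=.
  rewrite (le_trans xm)// /inner_end lerD2l lerN2 ler_pM2l//.
  by rewrite lef_pV2 ?posrE// ler_nat.
- by move=> k; apply/measurable_EFinP; exact: measurable_funS (sub k) mh.
- by move=> k t /sub; rewrite /= in_itv/= lee_fin; exact: h0.
Qed.

Definition radial_density (c a : R) n t : R := t ^+ n * (1 - t / c) `^ (a - 1).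

Section beta.
Variables (c a : R).
Hypotheses (c0 : 0 < c) (a0 : 0 < a).

Let w_gt0 t : t < c -> 0 < 1 - t / c.
Proof. by move=> tc; rewrite subr_gt0 ltr_pdivrMr// mul1r. Qed.

Let dw b t : t < c ->
  is_derive t 1 (fun t : R => (1 - t / c) `^ b) (- c^-1 * (b * (1 - t / c) `^ (b - 1))).
Proof.
move=> tc; have h : is_derive t 1 (fun t : R => 1 - t / c) (- c^-1).
  apply: is_derive_eq; rewrite /GRing.scale/=; ring.
rewrite mulrC.
exact: (@is_derive1_comp R (fun x => x `^ b) (fun t => 1 - t / c) t _ _
  (is_derive1_powR b (w_gt0 tc)) h).
Qed.

Lemma measurable_radial_density n D :
  measurable_fun D (radial_density c a n).
Proof.
apply: measurable_funTS; apply: measurable_funM; first exact: exprn_measurable.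
apply: (measurableT_comp (measurable_powR (a - 1))).
by apply: measurable_funB => //; exact: measurable_funM.
Qed.

Lemma radial_density_ge0 n t : 0 <= t -> 0 <= radial_density c a n t.
Proof. by move=> t0; rewrite mulr_ge0 ?exprn_ge0 ?powR_ge0. Qed.

Let cont_density n t : t < c -> {for t, continuous (radial_density c a n)}.
Proof.
move=> tc; apply: cvgM; first exact: exprn_continuous.
exact: is_derive_continuous (dw (a - 1) tc).
Qed.

Let inner n k := \int[mu]_(t in `[0, inner_end c k]) radial_density c a n t.

Let inner_integrable n k :
  mu.-integrable `[0, inner_end c k] (EFin \o radial_density c a n).
Proof.
apply: continuous_compact_integrable; first exact: segment_compact.
apply/continuous_in_subspaceT => x; rewrite inE/= in_itv/= => /andP[_ xk].
by apply: cont_density; rewrite (le_lt_trans xk)//; have /andP[] := inner_end_itv k c0.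
Qed.

Let innerE n k : (\int[mu]_(t in `[0%R, inner_end c k]) (radial_density c a n t)%:E =
  (inner n k)%:E)%E.
Proof.
by rewrite /inner /Rintegral fineK//; apply: integrable_fin_num => //; exact: inner_integrable.
Qed.

(** A primitive is [- (c / a) * (1 - t / c) `^ a]. *)
Lemma radial_integral0 :
  (\int[mu]_(t in `[0%R, c[) (radial_density c a 0 t)%:E = (c / a)%:E)%E.
Proof.
pose F t := - (c / a) * (1 - t / c) `^ a.
have FE k : (\int[mu]_(t in `[0%R, inner_end c k]) (radial_density c a 0 t)%:E =
    (F (inner_end c k) - F 0)%:E)%E.
  have /andP[k0 kc] := inner_end_itv k c0.
  apply: FTC_segment => // t /andP[t0 tk]; last first.
    by apply: cont_density; exact: le_lt_trans kc.
  have := is_deriveZ (- (c / a)) (dw a (le_lt_trans tk kc)).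
  rewrite /GRing.scale/= /radial_density expr0 mul1r.
  set p := _ `^ _; rewrite (_ : - (c / a) * _ = p)//.
  by field; rewrite !gt_eqF.
have cvgI : ((F (inner_end c k) - F 0)%:E @[k --> \oo] -->
    \int[mu]_(t in `[0%R, c[) (radial_density c a 0 t)%:E)%E.
  under eq_fun do rewrite -FE.
  apply: cvg_integral_inner => //; first exact: measurable_radial_density.
  by move=> t /andP[t0 _]; exact: radial_density_ge0.
apply: (cvg_unique (@ereal_hausdorff R) cvgI).
apply: cvg_EFin; first exact: nearW.
rewrite (_ : c / a = - (c / a) * 0 - F 0); last first.
  by rewrite /F mul0r subr0 powR1 mulr0 mulr1 sub0r opprK.
apply: cvgB; last exact: cvg_cst.
by apply: cvgM; [exact: cvg_cst | exact: cvg_inner_powR].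
Qed.

(** Integrating the derivative of [t ^+ n.+1 * (1 - t / c) `^ a], which
vanishes at both ends of the interval. *)
Lemma radial_integralS n (b : R) :
  (\int[mu]_(t in `[0%R, c[) (radial_density c a n t)%:E = b%:E)%E ->
  (\int[mu]_(t in `[0%R, c[) (radial_density c a n.+1 t)%:E =
   (c * n.+1%:R / (n.+1%:R + a) * b)%:E)%E.
Proof.
move=> nb; have cvgJ m : ((inner m k)%:E @[k --> \oo] -->
    \int[mu]_(t in `[0%R, c[) (radial_density c a m t)%:E)%E.
  under eq_fun do rewrite -innerE.
  apply: cvg_integral_inner => //; first exact: measurable_radial_density.
  by move=> t /andP[t0 _]; exact: radial_density_ge0.
have na0 : 0 < n.+1%:R + a by rewrite addr_gt0.
pose F t := t ^+ n.+1 * (1 - t / c) `^ a.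
have FE k : F (inner_end c k) =
    n.+1%:R * inner n k - (n.+1%:R + a) / c * inner n.+1 k.
  have /andP[k0 kc] := inner_end_itv k c0.
  pose f t := n.+1%:R * radial_density c a n t -
    (n.+1%:R + a) / c * radial_density c a n.+1 t.
  have : (\int[mu]_(t in `[0%R, inner_end c k]) (f t)%:E =
      (F (inner_end c k) - F 0)%:E)%E.
    apply: FTC_segment => // t /andP[t0 tk]; last first.
      have tc := le_lt_trans tk kc.
      by apply: cvgB; apply: cvgM; [exact: cvg_cst|exact: cont_density|
        exact: cvg_cst|exact: cont_density].
    have tc := le_lt_trans tk kc.
    have h1 : is_derive t 1 (fun x : R => x ^+ n.+1) (n.+1%:R * t ^+ n).
      apply: DeriveDef; first exact: exprn_derivable.
      by rewrite exp_derive /GRing.scale/= mulr1.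
    have := is_deriveM h1 (dw a tc); rewrite /GRing.scale/=.
    rewrite -(mulr_powRB1 (ltW (w_gt0 tc)) a0) => h2.
    apply: is_derive_eq; rewrite /f /radial_density exprS; set p := _ `^ _.
    by rewrite -[n.+1%:R]/(n.+1%:R : R); field; rewrite !gt_eqF.
  rewrite {2}/F expr0n/= mul0r subr0 => /(congr1 fine) /= <-.
  rewrite -[LHS]/(\int[mu]_(t in `[0, inner_end c k]) f t) RintegralB//; last 2 first.
  - by apply: (integrableZl _ n.+1%:R (inner_integrable n k)).
  - by apply: (integrableZl _ ((n.+1%:R + a) / c) (inner_integrable n.+1 k)).
  by rewrite !RintegralZl//; exact: inner_integrable.
have innerS k : inner n.+1 k =
    c / (n.+1%:R + a) * (n.+1%:R * inner n k - F (inner_end c k)).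
  by rewrite FE; field; rewrite nat1r !gt_eqF.
apply: (cvg_unique (@ereal_hausdorff R) (cvgJ n.+1)).
apply: cvg_EFin; first exact: nearW.
rewrite (_ : c * _ / _ * b = c / (n.+1%:R + a) * (n.+1%:R * b - c ^+ n.+1 * 0)); last first.
  by rewrite mulr0 subr0; ring.
under eq_fun do rewrite innerS.
apply: cvgM; first exact: cvg_cst.
apply: cvgB.
  apply: cvgM; first exact: cvg_cst.
  by have := cvgJ n; rewrite nb => /fine_cvgP[_ h]; exact: h.
apply: cvgM; last exact: cvg_inner_powR.
exact: (cvg_comp (inner_end c) (fun x : R => x ^+ n.+1) (@cvg_inner_end c)
  (@exprn_continuous _ _ _)).
Qed.

End beta.

End euler_integrals.

Section gamma_function.
Context {R : realType}.
Local Notation mu := (@lebesgue_measure R).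

Let g (b t : R) : R := t `^ b * expR (- t).

Let g_ge0 b t : 0 <= g b t.
Proof. by rewrite mulr_ge0 ?powR_ge0 ?expR_ge0. Qed.

Let is_derive_expR_comp (u : R -> R) (t du : R) : is_derive t 1 u du ->
  is_derive t 1 (fun x => expR (u x)) (expR (u t) * du).
Proof.
move=> h; exact: (@is_derive1_comp R (@expR R) u t _ _ (is_derive_expR (u t)) h).
Qed.

Let measurable_g b D : measurable_fun D (g b).
Proof.
apply: measurable_funTS; apply: measurable_funM; first exact: measurable_powR.
have h : measurable_fun setT (fun t : R => - t) by exact: measurable_funN.
exact: (measurableT_comp (@measurable_expR R) h).
Qed.

(** From [t / (2 * b) <= expR (t / (2 * b))], raised to the power [b]. *)
Let g_le_expR b t : 0 < b -> 0 <= t ->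
  g b t <= (2 * b) `^ b * expR (- (t / 2)).
Proof.
move=> b0 t0; have b20 : 0 < 2 * b by rewrite mulr_gt0.
have -> : expR (- (t / 2)) = expR (t / 2) * expR (- t).
  by rewrite -expRD; congr expR; lra.
rewrite mulrA ler_wpM2r ?expR_ge0//.
have -> : t `^ b = (2 * b) `^ b * (t / (2 * b)) `^ b.
  rewrite -powRM ?divr_ge0 ?(ltW b20)//; congr (_ `^ _).
  by rewrite mulrC divfK// gt_eqF.
rewrite ler_pM2l ?powR_gt0//.
have -> : t / 2 = t / (2 * b) * b by field; rewrite gt_eqF.
rewrite expRM ge0_ler_powR ?nnegrE ?divr_ge0 ?expR_ge0 ?(ltW b20) ?(ltW b0)//.
by have := expR_ge1Dx (t / (2 * b)); lra.
Qed.

Let integral_expR_half C : 0 <= C ->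
  (\int[mu]_(t in `[0%R, +oo[) (C * expR (- (t / 2)))%:E = (2 * C)%:E)%E.
Proof.
move=> C0; pose F t := - 2 * C * expR (- (t / 2)).
have dF (t : R) : is_derive t 1 F (C * expR (- (t / 2))).
  have h : is_derive t 1 (fun t : R => - (t / 2)) (- 2^-1).
    by apply: is_derive_eq; rewrite /GRing.scale/=; ring.
  have := is_deriveZ (- 2 * C) (is_derive_expR_comp h).
  by move=> h2; apply: (is_derive_eq h2); rewrite /GRing.scale/=; field.
rewrite (@ge0_continuous_FTC2y _ _ F _ 0).
- by rewrite /F mul0r oppr0 expR0 mulr1 -EFinB; congr EFin; ring.
- by move=> t _; rewrite mulr_ge0 ?expR_ge0.
- apply: continuous_subspaceT => t; apply: cvgM; first exact: cvg_cst.
  have h : {for t, continuous (fun t : R => - (t / 2))}.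
    by apply: cvgN; apply: cvgM; [exact: cvg_id|exact: cvg_cst].
  exact: (continuous_comp h (@continuous_expR _ _)).
- rewrite -[X in _ --> X](mulr0 (- 2 * C)); apply: cvgM; first exact: cvg_cst.
  apply: (cvg_comp (fun t : R => t / 2) (fun t => expR (- t)));
    last exact: cvgr_expR.
  by apply: gt0_cvgMly; [|exact: cvg_id].
- by move=> t _; have [] := dF t.
- by apply: cvg_at_right_filter; exact: is_derive_continuous (dF 0).
- by move=> t _; rewrite derive1E; have [] := dF t.
Qed.

Let integral_g_fin b : 0 < b ->
  (\int[mu]_(t in `[0%R, +oo[) (g b t)%:E < +oo)%E.
Proof.
move=> b0; have C0 : 0 <= (2 * b) `^ b by rewrite powR_ge0.
apply: le_lt_trans (ltry (2 * (2 * b) `^ b)); rewrite -integral_expR_half//.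
apply: ge0_le_integral => //.
- by move=> t _; rewrite lee_fin g_ge0.
- by apply/measurable_EFinP; exact: measurable_g.
- apply/measurable_EFinP; apply: measurable_funM => //.
  have h : measurable_fun (`[0%R, +oo[%classic : set R) (fun t : R => - (t / 2)).
    by apply: measurable_funN; exact: measurable_funM.
  exact: (measurableT_comp (@measurable_expR R) h).
- by move=> t /=; rewrite in_itv/= andbT lee_fin; exact: g_le_expR.
Qed.

Lemma GammaE (a : R) : 1 < a ->
  ((Gamma a)%:E = \int[mu]_(t in `[0%R, +oo[) (g (a - 1) t)%:E)%E.
Proof.
move=> a1; rewrite /Gamma /Rintegral integral_itv_obnd_cbnd; last first.
  by apply/measurable_EFinP; exact: measurable_g.
rewrite fineK// ge0_fin_numE; first by rewrite integral_g_fin// subr_gt0.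
by apply: integral_ge0 => t _; rewrite lee_fin g_ge0.
Qed.

Lemma Gamma_gt0 (a : R) : 1 < a -> 0 < Gamma a.
Proof.
move=> a1; rewrite -lte_fin GammaE//.
apply: (@lt_le_trans _ _ (\int[mu]_(t in `[1%R, 2%R]) (expR (- 2))%:E)%E).
  rewrite integral_cst//= lebesgue_measure_itv/= lte_fin ltr1n.
  by rewrite -EFinB -EFinM lte_fin mulr_gt0 ?expR_gt0//; lra.
apply: (@le_trans _ _ (\int[mu]_(t in `[1%R, 2%R]) (g (a - 1) t)%:E)%E).
  apply: ge0_le_integral => //=.
    by apply/measurable_EFinP; exact: measurable_g.
  move=> t; rewrite in_itv/= lee_fin => /andP[t1 t2].
  rewrite /g -[leLHS]mul1r ler_pM ?expR_ge0//; last by rewrite ler_expR lerN2.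
  rewrite -[leLHS](powRr0 t) ler_powR// ltW// subr_gt0//.
apply: ge0_subset_integral => //=.
- by apply/measurable_EFinP; exact: measurable_g.
- by move=> t _; rewrite lee_fin g_ge0.
- by move=> t /=; rewrite !in_itv/= andbT => /andP[t1 _]; rewrite (le_trans _ t1).
Qed.

(** Integrating the derivative of [t `^ a * expR (- t)] over [0, n + 1] and
letting [n] tend to infinity. *)
Lemma GammaS (a : R) : 1 < a -> Gamma (a + 1) = a * Gamma a.
Proof.
move=> a1; have a0 : 0 < a := lt_trans ltr01 a1.
have b0 : 0 < a - 1 by rewrite subr_gt0.
have cvgJ c : 0 < c -> (\int[mu]_(t in `[0%R, n.+1%:R%R]) (g c t)%:E @[n --> \oo] -->
    \int[mu]_(t in `[0%R, +oo[) (g c t)%:E)%E.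
  move=> c0; rewrite itv0y_bigcup0S.
  apply: ge0_nondecreasing_set_cvg_integral => //.
  - move=> m n mn; apply/subsetPset => x; rewrite /= !in_itv/= => /andP[-> xm].
    by rewrite (le_trans xm)// ler_nat.
  - by move=> n; apply/measurable_EFinP; exact: measurable_g.
  - by move=> n t _; rewrite lee_fin g_ge0.
have cont_g c : 0 < c -> {within `[0, +oo[, continuous (g c)}.
  move=> c0; apply/continuous_within_itvcyP; split=> [x|].
  - rewrite in_itv/= andbT => x0; apply: cvgM.
      exact: (is_derive_continuous (is_derive1_powR c x0)).
    have h : {for x, continuous (fun t : R => - t)} by apply: cvgN; exact: cvg_id.
    exact: (continuous_comp h (@continuous_expR _ _)).
  - rewrite /g powR0 ?gt_eqF// mul0r -[X in _ --> X](mul0r (expR (- 0))).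
    apply: cvgM; first exact: powR_cvg0.
    apply: cvg_at_right_filter.
    have h : {for (0:R), continuous (fun t : R => - t)} by apply: cvgN; exact: cvg_id.
    exact: (continuous_comp h (@continuous_expR _ _)).
have cont_gn c n : 0 < c -> {within `[0, n.+1%:R], continuous (g c)}.
  move=> c0; apply: continuous_subspaceW (cont_g c c0) => t /=.
  by rewrite !in_itv/= andbT => /andP[].
have int_g c n : 0 < c -> mu.-integrable `[0, n.+1%:R] (EFin \o g c).
  move=> c0; apply: continuous_compact_integrable; first exact: segment_compact.
  exact: cont_gn.
pose j c n := \int[mu]_(t in `[0, n.+1%:R]) g c t.
have jE c n : 0 < c -> (\int[mu]_(t in `[0%R, n.+1%:R%R]) (g c t)%:E = (j c n)%:E)%E.
  by move=> c0; rewrite /j /Rintegral fineK//; apply: integrable_fin_num => //; exact: int_g.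
have FTC n : g a n.+1%:R = a * j (a - 1) n - j a n.
  have : (\int[mu]_(t in `[0%R, n.+1%:R]) (a * g (a - 1) t - g a t)%:E =
      (g a n.+1%:R)%:E - (g a 0)%:E)%E.
    have dg (x : R) : 0 < x -> is_derive x 1 (g a) (a * g (a - 1) x - g a x).
      move=> x0; have h : is_derive x 1 (fun t : R => - t) (- 1).
        by apply: is_derive_eq.
      have := is_deriveM (is_derive1_powR a x0)
        (is_derive_expR_comp h).
      by move=> h2; apply: (is_derive_eq h2); rewrite /g /GRing.scale/=; ring.
    apply: continuous_FTC2 => //.
    - move=> x; apply: cvgB; last exact: cont_gn.
      by apply: cvgM; [exact: cvg_cst|exact: cont_gn].
    - split=> [x||].
      + by rewrite in_itv/= => /andP[x0 _]; have [] := dg x x0.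
      + by have /continuous_within_itvcyP[_] := cont_g a a0.
      + by apply: cvg_at_left_filter; apply: is_derive_continuous (dg _ _).
    - move=> x; rewrite in_itv/= => /andP[x0 _]; rewrite derive1E.
      by have [] := dg x x0.
  have -> : g a 0 = 0 by rewrite /g powR0 ?mul0r// gt_eqF.
  rewrite sube0 => /(congr1 fine) /= <-.
  rewrite -[LHS]/(\int[mu]_(t in `[0, n.+1%:R]) (a * g (a - 1) t - g a t)).
  rewrite RintegralB//; last 2 first.
  - by apply: (integrableZl _ a (int_g _ n b0)).
  - exact: int_g.
  by rewrite RintegralZl//; exact: int_g.
have jS n : j a n = a * j (a - 1) n - g a n.+1%:R by rewrite FTC; ring.
have cvgR c : 1 < c -> j (c - 1) n @[n --> \oo] --> Gamma c.
  move=> c1; have c0 : 0 < c - 1 by rewrite subr_gt0.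
  have := cvgJ _ c0; rewrite -GammaE// => /fine_cvgP[_].
  by under eq_fun do rewrite /= jE//=.
have := cvgR (a + 1); rewrite addrK ltr_pwDl// => /(_ isT) h.
suff cvgL : j a n @[n --> \oo] --> a * Gamma a.
  exact: (cvg_unique (@Rhausdorff R) h cvgL).
under eq_fun do rewrite jS.
rewrite -[a * Gamma a]subr0; apply: cvgB.
  by apply: cvgM; [exact: cvg_cst|exact: cvgR].
pose C : R := (2 * a) `^ a.
apply: (@squeeze_cvgr _ _ _ _ (fun=> 0) (fun n => C * expR (- (n.+1%:R / 2)))).
- by apply: nearW => n; rewrite g_ge0/= g_le_expR.
- exact: cvg_cst.
rewrite -[X in _ --> X](mulr0 C); apply: cvgM; first exact: cvg_cst.
apply: (cvg_comp (fun n => n.+1%:R / 2) (fun t => expR (- t)));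
    last exact: cvgr_expR.
have ny : (n.+1%:R : R) @[n --> \oo] --> +oo.
  by have := @cvgr_idn R; rewrite -(cvg_shiftS _ (pinfty_nbhs R)).
apply: (cvg_comp (fun n => n.+1%:R) (fun t : R => t / 2) ny).
by apply: gt0_cvgMly; [|exact: cvg_id].
Qed.

End gamma_function.

(** * Cauchy's theorem on circles, by homotopy *)

Section homotopy.
Context {R : realType}.
Local Notation mu := (@lebesgue_measure R).
Local Notation mu2 := (lebesgue2 R).

(** Both iterated integrals of [g] are computed by the fundamental theorem of
calculus: one vanishes because [P t] is periodic, the other one is the
difference of the two integrals to be compared. *)
Lemma homotopy_integral (G g P : R -> R -> R) (L : R) : 0 < L ->
  (forall t x : R, 0 <= t <= 1 -> is_derive t 1 (fun s => G s x) (g t x)) ->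
  (forall t x : R, 0 < t <= 1 -> is_derive x 1 (P t) (g t x)) ->
  (forall t, 0 < t <= 1 -> P t L = P t 0) ->
  (forall t x : R, 0 <= t <= 1 -> {for (t, x), continuous (fun z => g z.1 z.2)}) ->
  (forall t, 0 <= t <= 1 -> continuous (G t)) ->
  \int[mu]_(x in `[0, L]) G 1 x = \int[mu]_(x in `[0, L]) G 0 x.
Proof.
move=> L0 dG dP PL cg cG.
pose A : set (plane R) := `]0, 1] `*` `[0, L].
pose K : set (R * R) := `[0, 1] `*` `[0, L].
have AK z : A z -> K z.
  by case: z => t x [/=]; rewrite !in_itv/= => /andP[t0 t1] xL; split;
    rewrite /= in_itv//= ltW.
have mA : measurable A by apply: measurableX.
have cgx t x : 0 <= t <= 1 -> {for x, continuous (g t)}.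
  move=> t01; have ci : {for x, continuous (fun y : R => (t, y))}.
    exact: (cvg_pair (cvg_cst t) cvg_id).
  exact: (continuous_comp ci (cg t x t01)).
have cgt t x : 0 <= t <= 1 -> {for t, continuous (fun s => g s x)}.
  move=> t01; have ci : {for t, continuous (fun s : R => (s, x))}.
    exact: (cvg_pair cvg_id (cvg_cst x)).
  exact: (continuous_comp ci (cg t x t01)).
have gA : mu2.-integrable A (fun z => (g z.1 z.2)%:E).
  apply: (measurable_bounded_integrable (f := fun z : plane R => g z.1 z.2)).
  - exact: mA.
  - have muA : mu2 A = (mu `]0%R, 1%R] * mu `[0%R, L])%E.
      by apply: product_measure1E.
    change (mu2 A < +oo)%E; rewrite muA !lebesgue_measure_itv/= !lte_fin ltr01 L0.
    by rewrite -!EFinB -EFinM ltry.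
  - apply: continuous_at_measurable => // -[t x] /AK[/=].
    by rewrite !in_itv/= => t01 _; exact: cg.
  - have cK : compact K by apply: compact_setX; exact: segment_compact.
    have : compact ((fun z => g z.1 z.2) @` K).
      apply: continuous_compact => //; apply/continuous_in_subspaceT.
      by move=> [t x]; rewrite inE => -[/=]; rewrite !in_itv/= => t01 _; exact: cg.
    move=> /compact_bounded[M [Mr hM]]; exists M; split => // N MN z /AK Kz.
    by apply: (hM N MN); exists z.
pose f : plane R -> \bar R := (fun z => (g z.1 z.2)%:E) \_ A.
have intf : (mu \x mu)%E.-integrable setT f by exact/(integrable_mkcond _ mA).
have := Fubini intf.
have -> : (\int[mu]_x \int[mu]_y f (x, y) = 0)%E.
  apply: integral0_eq => t _.
  have [t01|t01] := boolP (t \in `]0%R, 1%R]%classic); last first.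
    apply: integral0_eq => x _; rewrite /f patchE ifF//.
    apply/negbTE/negP; rewrite inE => -[/= t01' _].
    by move/negP : t01; apply; rewrite inE.
  move: t01; rewrite inE/= in_itv/= => t01.
  transitivity (\int[mu]_(x in `[0%R, L]) (g t x)%:E)%E.
    rewrite [RHS]integral_mkcond; apply: eq_integral => x _.
    rewrite /f !patchE; congr (if _ then _ else _).
    by apply/idP/idP; rewrite !inE/= /A/= !in_itv/= t01 => // -[].
  rewrite (FTC_segment L0 (fun x _ => dP t x t01)).
    by rewrite PL// subrr.
  by move=> x _; apply: cgx; case/andP: t01 => /ltW -> ->.
have -> : (\int[mu]_y \int[mu]_x f (x, y) =
    \int[mu]_(x in `[0%R, L]) (G 1 x - G 0 x)%:E)%E.
  rewrite [RHS]integral_mkcond; apply: eq_integral => x _; rewrite patchE.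
  case: ifPn => [|xL]; last first.
    apply: integral0_eq => t _; rewrite /f patchE ifF//.
    apply/negbTE/negP; rewrite inE => -[/= _ xL'].
    by move/negP : xL; apply; rewrite inE.
  rewrite inE/= in_itv/= => xL.
  transitivity (\int[mu]_(t in `]0%R, 1%R]) (g t x)%:E)%E.
    rewrite [RHS]integral_mkcond; apply: eq_integral => t _.
    rewrite /f !patchE; congr (if _ then _ else _).
    by apply/idP/idP; rewrite !inE/= /A/= !in_itv/= xL => // -[].
  have mgx : measurable_fun (`[0%R, 1%R]%classic : set R) (fun t => g t x).
    apply: subspace_continuous_measurable_fun => //.
    apply/continuous_in_subspaceT => t; rewrite inE/= in_itv/=; exact: cgt.
  rewrite (@integral_itv_obnd_cbnd _ 0 (BRight 1) (fun t => (g t x)%:E)).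
    exact: (FTC_segment ltr01 (fun t => dG t x) (fun t => @cgt t x)).
  apply/measurable_EFinP; apply: measurable_funS mgx => // t /=.
  by rewrite !in_itv/= => /andP[/ltW -> ->].
move/esym/(congr1 fine); rewrite /= -[LHS]/(\int[mu]_(x in `[0, L]) (G 1 x - G 0 x)).
have iG t : 0 <= t <= 1 -> mu.-integrable `[0, L] (EFin \o G t).
  move=> t01; apply: continuous_compact_integrable; first exact: segment_compact.
  exact/continuous_subspaceT/cG.
have i0 : 0 <= (0 : R) <= 1 by rewrite lexx ler01.
have i1 : 0 <= (1 : R) <= 1 by rewrite lexx ler01.
by rewrite RintegralB//; [move/subr0_eq|exact: iG|exact: iG].
Qed.

End homotopy.

Section slice_curves.
Context {R : realType} (I : quaternion R) (HI : imag_units I).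

Lemma slice_is_linear : linear (slice I).
Proof. by move=> a z w; rewrite sliceD slice_scale. Qed.

HB.instance Definition _ :=
  GRing.isLinear.Build R (R * R)%type (quaternion R) *:%R (slice I) slice_is_linear.

Lemma continuous_slice : continuous (slice I).
Proof.
move=> z; apply: cvgD; apply: cvgZr_tmp; [exact: cvg_fst|exact: cvg_snd].
Qed.

Lemma differentiable_slice z : differentiable (slice I) z.
Proof. by apply: linear_differentiable; exact: continuous_slice. Qed.

Lemma is_derive_slice (c : R -> R * R) (t : R) (dc : R * R) :
  is_derive t 1 c dc -> is_derive t 1 (fun s => slice I (c s)) (slice I dc).
Proof.
move=> /is_derive_cvgP cdc; apply/is_derive_cvgP.
rewrite (_ : (fun h => _) = fun h : R =>
    slice I (h^-1 *: (c (h *: (1 : R) + t) - c t))).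
  exact: (cvg_comp _ (slice I) cdc (@continuous_slice _)).
by apply/funext => h; rewrite slice_scale sliceB.
Qed.

Lemma is_derive_pair (u v : R -> R) (t du dv : R) :
  is_derive t 1 u du -> is_derive t 1 v dv ->
  is_derive t 1 (fun s => (u s, v s)) (du, dv).
Proof.
move=> /is_derive_cvgP h1 /is_derive_cvgP h2; apply/is_derive_cvgP.
exact: (cvg_pair h1 h2).
Qed.

Lemma cvg_cis t : cis @ t --> (cis t : R * R).
Proof. exact: (cvg_pair (@continuous_cos _ _) (@continuous_sin _ _)). Qed.

Lemma is_derive_cis (c t : R) : is_derive t 1 (fun s => cis (c * s))
  (c *: cmul (0, 1) (cis (c * t))).
Proof.
have dc : is_derive t 1 (fun s : R => c * s) c.
  by apply: is_derive_eq; rewrite /GRing.scale/= mulr1.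
have d1 := @is_derive1_comp R (@cos R) _ t _ _ (is_derive_cos (c * t)) dc.
have d2 := @is_derive1_comp R (@sin R) _ t _ _ (is_derive_sin (c * t)) dc.
have := is_derive_pair d1 d2; congr is_derive.
by rewrite /cmul/=; congr (_, _); rewrite /GRing.scale/=; ring.
Qed.

Section regular.
Variables (r : R) (f : quaternion R -> quaternion R).
Hypothesis (fr : slice_regular r f).

Definition slice_deriv (z : R * R) : quaternion R :=
  'D_((1, 0) : R * R) (f \o slice I) z.

Lemma slice_deriv_continuous z : slice_ball r I z ->
  {for z, continuous slice_deriv}.
Proof.
by move=> rz; have [_ reg] := fr; have [_ cD _ _] := reg I HI z rz; exact: cD.
Qed.

(** The Cauchy-Riemann equation makes the differential of [f] on the slice
left multiplication of the derivative by a vector of the slice. *)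
Lemma is_derive_along (c : R -> R * R) (t : R) (dc : R * R) : is_derive t 1 c dc ->
  slice_ball r I (c t) ->
  is_derive t 1 (fun s => f (slice I (c s))) (slice I dc * slice_deriv (c t)).
Proof.
move=> cdc rz; set z := c t.
have dF : differentiable (f \o slice I) z.
  apply: differentiable_comp; first exact: differentiable_slice.
  by have [h _] := fr; exact: h.
have dcd : differentiable c t by apply/derivable1_diffP; case: cdc.
have dFc : differentiable ((f \o slice I) \o c) t by exact: differentiable_comp.
have [_ /(_ I HI z rz)[_ _ _ CR]] := fr.
split; first exact: diff_derivable.
rewrite (deriveE (1 : R) dFc) (diff_comp dcd dF) [LHS]/comp -/z.
have -> : 'd c t 1 = dc by rewrite -deriveE//; case: cdc.
have -> : dc = dc.1 *: ((1, 0) : R * R) + dc.2 *: ((0, 1) : R * R).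
  case: dc {cdc} => a b; rewrite [RHS]surjective_pairing/=.
  by rewrite !scaler0 addr0 add0r /GRing.scale/= !mulr1.
rewrite linearD !linearZ/= -!deriveE// sliceD !slice_scale mulrDl.
rewrite -!scalerAl slice_imag slice_real scale1r mul1r; congr (_ + _ *: _).
rewrite -[LHS]opprK -[in LHS]mulN1r -(imag_unit_sqr HI) -mulrA mulrN.
congr (_ * _); apply/eqP; rewrite eq_sym -subr_eq0 opprK.
by rewrite CR.
Qed.

End regular.

End slice_curves.

Section circle_integrals.
Context {R : realType}.
Local Notation mu := (@lebesgue_measure R).
Local Notation tau := (pi *+ 2 : R).

Lemma Rintegral_sum d (T : measurableType d) (m : {measure set T -> \bar R})
    (D : set T) n (h : nat -> T -> R) : measurable D ->
  (forall k, m.-integrable D (EFin \o h k)) ->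
  m.-integrable D (EFin \o (fun x => \sum_(k < n) h k x)) /\
  \int[m]_(x in D) (\sum_(k < n) h k x) = \sum_(k < n) \int[m]_(x in D) h k x.
Proof.
move=> mD ih; elim: n => [|n [IHi IH]].
  split.
    by under eq_fun do rewrite /= big_ord0; exact: integrable0.
  rewrite big_ord0; under eq_Rintegral do rewrite big_ord0.
  by rewrite Rintegral_cst// mul0r.
split.
  rewrite (_ : _ \o _ = fun x => ((\sum_(k < n) h k x)%:E + (h n x)%:E)%E).
    by apply: integrableD => //; exact: ih.
  by apply/funext => x; rewrite /= big_ord_recr.
under eq_Rintegral do rewrite big_ord_recr.
by rewrite RintegralD// IH big_ord_recr.
Qed.

Lemma tau_gt0 : 0 < tau. Proof. by rewrite pmulrn_lgt0// pi_gt0. Qed.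

Definition circle_int (h : R -> R) : R := \int[mu]_(x in `[0, tau]) h x.

Lemma circle_integrable (h : R -> R) : continuous h ->
  mu.-integrable `[0, tau] (EFin \o h).
Proof.
move=> ch; apply: continuous_compact_integrable; first exact: segment_compact.
exact: continuous_subspaceT.
Qed.

Lemma circle_intD (h k : R -> R) : continuous h -> continuous k ->
  circle_int (fun x => h x + k x) = circle_int h + circle_int k.
Proof. by move=> ch ck; rewrite /circle_int RintegralD//; exact: circle_integrable. Qed.

Lemma circle_intB (h k : R -> R) : continuous h -> continuous k ->
  circle_int (fun x => h x - k x) = circle_int h - circle_int k.
Proof. by move=> ch ck; rewrite /circle_int RintegralB//; exact: circle_integrable. Qed.

Lemma circle_intZ c (h : R -> R) : continuous h ->
  circle_int (fun x => c * h x) = c * circle_int h.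
Proof. by move=> ch; rewrite /circle_int RintegralZl//; exact: circle_integrable. Qed.

Lemma circle_int_sum n (h : nat -> R -> R) : (forall k, continuous (h k)) ->
  circle_int (fun x => \sum_(k < n) h k x) = \sum_(k < n) circle_int (h k).
Proof.
move=> ch; have ih k := circle_integrable (ch k).
have mD : measurable (`[0, tau]%classic : set (measurableTypeR R)) by [].
by have [] := @Rintegral_sum _ (measurableTypeR R) mu _ n h mD ih.
Qed.

Lemma circle_int_cst c : circle_int (fun=> c) = tau * c.
Proof.
have mE : mu (`[0%R, tau]%classic : set R) = tau%:E.
  by rewrite lebesgue_measure_itv/= lte_fin tau_gt0 oppr0 adde0.
rewrite /circle_int Rintegral_cst// mulrC; congr (_ * _).
exact: (congr1 fine mE).
Qed.

Lemma le_circle_int (h : R -> R) c : continuous h -> (forall x, h x <= c) ->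
  circle_int h <= tau * c.
Proof.
move=> ch hc; rewrite -circle_int_cst; apply: le_Rintegral => //.
  exact: circle_integrable.
by apply: circle_integrable => x; exact: cvg_cst.
Qed.

Definition circle_qint (h : R -> quaternion R) : quaternion R :=
  Quat (circle_int (fun x => qre (h x))) (circle_int (fun x => qi (h x)))
       (circle_int (fun x => qj (h x))) (circle_int (fun x => qk (h x))).

Lemma qcoord_circle_qint p (h : R -> quaternion R) : continuous h ->
  qcoord p (circle_qint h) = circle_int (fun x => qcoord p (h x)).
Proof.
move=> ch; rewrite /qcoord/=.
have C s : continuous (fun x => qcoord s (h x)) by move=> x; apply: cvg_qcoord; exact: ch.
have [c1 c2 c3 c4] : [/\ continuous (fun x => qre (h x)),
    continuous (fun x => qi (h x)), continuous (fun x => qj (h x)) &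
    continuous (fun x => qk (h x))].
  by rewrite qre_qcoord qi_qcoord qj_qcoord qk_qcoord; split; exact: C.
have Z a (u : R -> R) : continuous u -> continuous (fun x => a * u x).
  move=> cu x; apply: cvgM; first exact: cvg_cst.
  exact: cu.
have B (u w : R -> R) : continuous u -> continuous w ->
    continuous (fun x => u x - w x).
  by move=> cu cw x; apply: cvgB; [exact: cu|exact: cw].
rewrite !circle_intB ?circle_intZ//.
all: by repeat first [assumption|refine (Z _ _ _)|refine (B _ _ _ _)].
Qed.


Lemma geometric_le0 (a c q : R) : 0 <= q < 1 ->
  (forall n, a <= c * q ^+ n) -> a <= 0.
Proof.
move=> /andP[q0 q1] h.
have cq : (fun n => c * q ^+ n) @ \oo --> (0 : R).
  rewrite -[0 in X in _ --> X](mulr0 c); apply: cvgM; first exact: cvg_cst.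
  by apply: cvg_expr; rewrite ger0_norm.
by apply: (ler_cvg_to (cvg_cst a) cq); exact: nearW.
Qed.

End circle_integrals.

(** * Power series expansion of slice regular functions *)

Section taylor.
Context {R : realType} (I : quaternion R) (HI : imag_units I).
Variables (r : R) (f : quaternion R -> quaternion R).
Hypothesis (fr : slice_regular r f).
Local Notation tau := (pi *+ 2 : R).
Local Notation S := (slice I).

(** Cauchy's formula for the coefficients: the mean of [w ^- k * f w] on the
circle of radius [rho]; for [w = rho *: cis x], the factor [w ^- k] is
[rho ^- k] times [cis (- k%:R * x)]. *)
Definition taylor_coef (rho : R) (k : nat) : quaternion R :=
  (tau^-1 * rho ^- k) *:
  circle_qint (fun x => S (cis (- k%:R * x)) * f (S (rho *: cis x))).

Section at_point.
Variables (rho : R) (z : R * R).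
Hypotheses (rho0 : 0 < rho) (rho_r : rho < r) (z_rho : `|S z| < rho).

Let w x : R * R := rho *: cis x.
Let gam t x : R * R := z + t *: (w x - z).
(* K is the Cauchy kernel w / (w - z), and u the ratio z / w of its geometric
   expansion; gam t contracts the circle onto z as t goes to 0. *)
Let K x := S (w x) * qinv (S (w x - z)).
Let u x := S z * (rho^-1 *: S (cis (- x))).
Let q := `|S z| / rho.

Let norm_w x : `|S (w x)| = rho.
Proof. by rewrite slice_scale normrZ norm_slice_cis// mulr1 gtr0_norm. Qed.

Let q_ge0 : 0 <= q. Proof. by rewrite divr_ge0// ltW. Qed.

Let q_lt1 : q < 1. Proof. by rewrite ltr_pdivrMr// mul1r. Qed.

Let norm_wz x : rho - `|S z| <= `|S (w x - z)|.
Proof. by rewrite sliceB -(norm_w x); exact: lerB_dist. Qed.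

Let wz_neq0 x : S (w x - z) != 0.
Proof. by rewrite -normr_gt0 (lt_le_trans _ (norm_wz x))// subr_gt0. Qed.

Let gam_ball t x : 0 <= t <= 1 -> slice_ball r I (gam t x).
Proof.
move=> /andP[t0 t1]; rewrite /slice_ball/qball/=.
apply: (@le_lt_trans _ _ rho) => //.
have -> : gam t x = (1 - t) *: z + t *: w x.
  by rewrite /gam scalerBr scalerBl scale1r addrA addrAC.
rewrite sliceD 2!slice_scale (le_trans (ler_normD _ _))// !normrZ norm_w.
have s0 : 0 <= 1 - t by rewrite subr_ge0.
rewrite !ger0_norm//; move: z_rho; set a := `|S z| => ar; nra.
Qed.

Let gam1 x : gam 1 x = w x. Proof. by rewrite /gam scale1r addrC subrK. Qed.

Let gam0 x : gam 0 x = z. Proof. by rewrite /gam scale0r addr0. Qed.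

Let is_derive_w (x : R) : is_derive x 1 w (cmul (0, 1) (w x)).
Proof.
have := is_deriveZ rho (is_derive_cis 1 x).
rewrite (_ : rho \*: _ = w); last by apply/funext => s; rewrite /= mul1r.
move=> h; apply: (is_derive_eq h); rewrite scale1r mul1r /cmul/w/=.
by rewrite [LHS]surjective_pairing/= /GRing.scale/=; congr (_, _); ring.
Qed.

Let cvg_w (x : R) : w @ x --> w x.
Proof. by apply: cvgZl_tmp; exact: cvg_cis. Qed.

Let cvg_Sw (x : R) : (fun y => S (w y)) @ x --> S (w x).
Proof. exact: (cvg_comp w S (@cvg_w x) (@continuous_slice R I _)). Qed.

Let cvg_K (x : R) : K @ x --> K x.
Proof.
apply: cvg_quatM; first exact: cvg_Sw.
apply: cvg_qinv; first exact: wz_neq0.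
have h : (fun y => w y - z) @ x --> w x - z.
  by apply: cvgB; [exact: cvg_w|exact: cvg_cst].
exact: (cvg_comp _ S h (@continuous_slice R I _)).
Qed.

Let f_cont (v : R * R) : slice_ball r I v -> (fun y => f (S y)) @ v --> f (S v).
Proof.
move=> rv; have [fd _] := fr.
exact: (cvg_comp S f (@continuous_slice R I v)
  (differentiable_continuous (fd _ rv))).
Qed.

(** Along the contraction [gam] of the circle onto [z], both partial
derivatives of [f] are left multiples of its slice derivative, which makes
the [t]-derivative of the integrand an exact derivative in the angle. *)
Lemma cauchy_circle p :
  circle_int (fun x => qcoord (p * K x) (f (S (w x)))) =
  circle_int (fun x => qcoord (p * K x) (f (S z))).
Proof.
pose G t x := qcoord (p * K x) (f (S (gam t x))).
pose g t x := qcoord (p * S (w x)) (slice_deriv I f (gam t x)).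
pose P t x := qcoord (p * (- t^-1 *: I)) (f (S (gam t x))).
transitivity (circle_int (G 1)).
  by congr circle_int; apply/funext => x; rewrite /G gam1.
transitivity (circle_int (G 0)); last first.
  by congr circle_int; apply/funext => x; rewrite /G gam0.
rewrite /circle_int.
apply: (@homotopy_integral R G g P tau (@tau_gt0 R)).
- move=> t x t01.
  have dgam : is_derive t 1 (fun s => gam s x) (w x - z).
    apply/is_derive_cvgP; rewrite (_ : (fun h : R => _) = fun h => h^-1 *: (h *: (w x - z))).
      apply: (@cvg_trans _ ((fun=> w x - z) @ 0^')); last exact: cvg_cst.
      apply: near_eq_cvg; near=> h; rewrite scalerA mulVf ?scale1r//.
      by near: h; exact: nbhs_dnbhs_neq.
    apply/funext => h; congr (_ *: _).
    by rewrite /gam opprD addrACA subrr add0r -scalerBl [h *: 1]mulr1 addrK.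
  have := is_derive_along HI fr dgam (gam_ball x t01).
  move=> /(is_derive_qcoord (p * K x)) h; apply: (is_derive_eq h).
  by rewrite /g /qcoord/K !mulrA -(mulrA _ (qinv _)) mulVq ?mulr1.
- move=> t x /andP[t0 t1]; have t01 : 0 <= t <= 1 by rewrite ltW.
  have dgam : is_derive x 1 (gam t) (t *: cmul (0, 1) (w x)).
    have h1 : is_derive x 1 (fun=> z - t *: z) 0 by exact: is_derive_cst.
    have h2 := is_deriveD h1 (is_deriveZ t (is_derive_w x)).
    rewrite (_ : gam t = (fun=> z - t *: z) + t \*: w).
      by apply: (is_derive_eq h2); rewrite add0r.
    by apply/funext => s; rewrite /gam scalerBr /= addrA addrAC.
  have := is_derive_along HI fr dgam (gam_ball x t01).
  move=> /(is_derive_qcoord (p * (- t^-1 *: I))) h; apply: (is_derive_eq h).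
  rewrite /g /qcoord slice_scale -(sliceM HI) slice_imag.
  have -> : p * S (w x) = p * ((- t^-1 *: I) * (t *: (I * S (w x)))).
    congr (_ * _).
    rewrite -scalerAl -scalerAr scalerA mulrA (imag_unit_sqr HI) mulN1r scalerN.
    by rewrite mulNr scaleNr opprK mulVf ?scale1r// gt_eqF.
  by rewrite !mulrA.
- by move=> t _; rewrite /P /gam/w /cis cos2pi sin2pi cos0 sin0.
- move=> t x t01.
  have h2 : (fun y : R * R => y.2) @ (t, x) --> x by exact: cvg_snd.
  have h1 : (fun y : R * R => y.1) @ (t, x) --> t by exact: cvg_fst.
  have cw2 := cvg_comp (fun y : R * R => y.2) w h2 (@cvg_w x).
  have cgam : (fun y : R * R => gam y.1 y.2) @ (t, x) --> gam t x.
    apply: cvgD; first exact: cvg_cst.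
    by apply: cvgZ => //; apply: cvgB => //; exact: cvg_cst.
  have cD := cvg_comp (fun y : R * R => gam y.1 y.2) (slice_deriv I f) cgam
    (@slice_deriv_continuous _ _ HI _ _ fr _ (gam_ball x t01)).
  have cS := cvg_comp _ S cw2 (@continuous_slice R I _).
  by apply: cvg_qcoord2 cD; apply: cvg_quatM cS; exact: cvg_cst.
- move=> t t01 x.
  have cgam : gam t @ x --> gam t x.
    apply: cvgD; first exact: cvg_cst.
    by apply: cvgZl_tmp; apply: cvgB; [exact: cvg_w|exact: cvg_cst].
  have cF := cvg_comp (gam t) (fun v => f (S v)) cgam (f_cont (gam_ball x t01)).
  by apply: cvg_qcoord2 cF; apply: cvg_quatM (@cvg_K x); exact: cvg_cst.
Unshelve. all: by end_near.
Qed.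



Let norm_K x : `|K x| <= (1 - q)^-1.
Proof.
rewrite norm_quatM norm_qinv norm_w.
have zr : 0 < rho - `|S z| by rewrite subr_gt0.
rewrite (_ : (1 - q)^-1 = rho / (rho - `|S z|)).
  by rewrite ler_pM2l// lef_pV2// posrE// (lt_le_trans zr)//; exact: norm_wz.
by rewrite /q; field; rewrite !gt_eqF.
Qed.

Let norm_u x : `|u x| = q.
Proof.
rewrite norm_quatM normrZ norm_slice_cis// mulr1 ger0_norm ?invr_ge0 ?ltW//.
Qed.

Let u_w x : u x * S (w x) = S z.
Proof.
rewrite /u slice_scale -mulrA -scalerAl -!scalerAr scalerA mulVf ?gt_eqF//.
rewrite scale1r (sliceM HI) (_ : cmul _ _ = (1, 0)) ?slice_real ?scale1r ?mulr1//.
rewrite /cmul/cis/= cosN sinN mulNr opprK -!expr2 cos2Dsin2; congr (_, _).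
by rewrite mulNr [sin x * _]mulrC subrr.
Qed.

Let K_rec x : K x = 1 + u x * K x.
Proof.
have Kwz : K x * S (w x - z) = S (w x) by rewrite /K -mulrA mulVq ?mulr1.
have : K x * S (w x - z) = (1 + u x * K x) * S (w x - z).
  by rewrite mulrDl mul1r -mulrA Kwz u_w sliceB subrK.
move/(congr1 (fun s => s * qinv (S (w x - z)))).
by rewrite -!mulrA mulqV// !mulr1.
Qed.

Let K_geometric x N : K x = \sum_(k < N) u x ^+ k + u x ^+ N * K x.
Proof.
elim: N => [|N IH]; first by rewrite big_ord0 add0r expr0 mul1r.
rewrite {1}IH {1}K_rec mulrDr mulr1 addrA big_ord_recr/=.
by rewrite exprSr mulrA.
Qed.

Let uX x k : u x ^+ k = S z ^+ k * (rho ^- k *: S (cis (- k%:R * x))).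
Proof.
rewrite exprMn_comm; last first.
  by rewrite /GRing.comm -scalerAr -scalerAl slice_comm.
by rewrite exprZn slice_cisX// exprVn mulrN mulNr.
Qed.

Let cvg_cisN k (x : R) : (fun y => S (cis (- k%:R * y))) @ x --> S (cis (- k%:R * x)).
Proof.
have h : (fun y : R => - k%:R * y) @ x --> - k%:R * x.
  by apply: cvgM; [exact: cvg_cst|exact: cvg_id].
exact: (cvg_comp _ S (cvg_comp _ _ h (@cvg_cis R _)) (@continuous_slice R I _)).
Qed.

Let cvg_uX k (x : R) : (fun y => u y ^+ k) @ x --> u x ^+ k.
Proof.
rewrite uX; under eq_fun do rewrite uX.
by apply: cvg_quatM; [exact: cvg_cst|apply: cvgZl_tmp; exact: cvg_cisN].
Qed.

Let circle_int_geometric p (V : R -> quaternion R) N : continuous V ->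
  circle_int (fun x => qcoord (p * K x) (V x)) =
  \sum_(k < N) circle_int (fun x => qcoord (p * u x ^+ k) (V x)) +
  circle_int (fun x => qcoord (p * (u x ^+ N * K x)) (V x)).
Proof.
move=> cV.
have c1 k : continuous (fun x => qcoord (p * u x ^+ k) (V x)).
  by move=> x; apply: cvg_qcoord2 (cV x); apply: cvg_quatM (@cvg_uX k x); exact: cvg_cst.
have c2 : continuous (fun x => qcoord (p * (u x ^+ N * K x)) (V x)).
  move=> x; apply: cvg_qcoord2 (cV x); apply: cvg_quatM; first exact: cvg_cst.
  exact: cvg_quatM (@cvg_uX N x) (@cvg_K x).
rewrite -(@circle_int_sum R N (fun k x => qcoord (p * u x ^+ k) (V x)))//.
rewrite -circle_intD//; last first.
  elim: N {c2} => [|N IH].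
    rewrite (_ : (fun x => _) = fun=> 0); first by move=> x; exact: cvg_cst.
    by apply/funext => x; rewrite big_ord0.
  rewrite (_ : (fun x => _) = fun x => \sum_(k < N) qcoord (p * u x ^+ k) (V x) +
      qcoord (p * u x ^+ N) (V x)).
    by move=> x; apply: cvgD; [exact: IH|exact: c1].
  by apply/funext => x; rewrite big_ord_recr.
congr circle_int; apply/funext => x; rewrite {1}(K_geometric x N) /qcoord.
by rewrite mulrDr mulrDl mulr_sumr mulr_suml qreD (qre_sum N (fun k => _ * u x ^+ k * _)).
Qed.

Let remainder_le p (V : R -> quaternion R) N M : continuous V ->
  (forall x, `|V x| <= M) ->
  circle_int (fun x => qcoord (p * (u x ^+ N * K x)) (V x)) <=
  tau * (`|p| * (M * (q ^+ N / (1 - q)))).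
Proof.
move=> cV VM; apply: le_circle_int => x.
  apply: cvg_qcoord2 (cV x); apply: cvg_quatM; first exact: cvg_cst.
  exact: cvg_quatM (@cvg_uX N x) (@cvg_K x).
apply: (le_trans (ler_norm _)); apply: (le_trans (le_qcoord_norm _ _)).
rewrite 2!norm_quatM norm_quatX norm_u -mulrA ler_wpM2l// mulrC.
by rewrite ler_pM ?mulr_ge0 ?exprn_ge0// ler_wpM2l ?exprn_ge0.
Qed.

Let circle_int_cis s k : circle_int (fun x => qcoord s (S (cis (- k.+1%:R * x)))) = 0.
Proof.
pose Q x := qcoord (s * (k.+1%:R^-1 *: I)) (S (cis (- k.+1%:R * x))).
have dQ (x : R) : is_derive x 1 Q (qcoord s (S (cis (- k.+1%:R * x)))).
  have h := is_derive_slice I (is_derive_cis (- k.+1%:R) x).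
  apply: (is_derive_eq (is_derive_qcoord _ h)).
  rewrite /qcoord slice_scale -(sliceM HI) slice_imag; congr (qre _).
  rewrite -mulrA; congr (_ * _).
  rewrite -scalerAl -scalerAr scalerA mulrA (imag_unit_sqr HI) mulN1r scalerN.
  by rewrite mulrN scaleNr opprK mulVf ?scale1r// pnatr_eq0.
have cQ (x : R) : {for x, continuous (fun x : R => qcoord s (S (cis (- k.+1%:R * x))))}.
  by apply: cvg_qcoord; exact: cvg_cisN.
rewrite /circle_int /Rintegral.
rewrite (FTC_segment (@tau_gt0 R) (fun x _ => dQ x) (fun x _ => cQ x))/=.
rewrite /Q mulr0 mulNr -mulrN -!(slice_cisX HI).
rewrite /cis cosN sinN cos2pi sin2pi oppr0 cos0 sin0 slice_real scale1r.
by rewrite expr1n subrr.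
Qed.

(* The powers of u with positive exponent have mean zero on the circle, and the
   remainder of the geometric series is arbitrarily small. *)
Let circle_int_kernel p : circle_int (fun x => qcoord (p * K x) 1) = tau * qre p.
Proof.
have c1 : continuous (fun _ : R => 1 : quaternion R) by move=> x; exact: cvg_cst.
have E N p' : circle_int (fun x => qcoord (p' * K x) 1) = tau * qre p' +
    circle_int (fun x => qcoord (p' * (u x ^+ N.+1 * K x)) 1).
  rewrite (circle_int_geometric p' N.+1 c1); congr (_ + _).
  rewrite big_ord_recl/= big1 ?addr0.
    rewrite -circle_int_cst; congr circle_int; apply/funext => x.
    by rewrite expr0 /qcoord !mulr1.
  move=> k _; rewrite -[RHS](circle_int_cis (rho ^- k.+1 *: (p' * S z ^+ k.+1)) k).
  congr circle_int; apply/funext => x; rewrite /qcoord mulr1 uX.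
  by rewrite !mulrA -scalerAr -scalerAl -mulrA.
have L p' N : circle_int (fun x => qcoord (p' * K x) 1) - tau * qre p' <=
    tau * (`|p'| * (1 * (q ^+ N.+1 / (1 - q)))).
  rewrite (E N) addrC addKr; apply: remainder_le => // _.
  by rewrite norm_quat1.
have L0 p' : circle_int (fun x => qcoord (p' * K x) 1) - tau * qre p' <= 0.
  apply: (@geometric_le0 _ _ (tau * (`|p'| * (q / (1 - q)))) q).
    by rewrite q_ge0 q_lt1.
  by move=> N; apply: (le_trans (L p' N)); rewrite exprS mul1r -!mulrA (mulrC (_ ^+ N)).
apply/eqP; rewrite eq_le -subr_le0 L0/= -subr_ge0 -oppr_le0.
have := L0 (- p); rewrite qreN mulrN !opprK.
rewrite (_ : (fun x => qcoord (- p * K x) 1) = fun x => -1 * qcoord (p * K x) 1).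
  rewrite circle_intZ; first by move=> h; rewrite opprB addrC -mulN1r.
  by move=> x; apply: cvg_qcoord2 (c1 x); apply: cvg_quatM (@cvg_K x); exact: cvg_cst.
by apply/funext => x; rewrite /qcoord !mulr1 !mulNr mul1r.
Qed.

(** The remainder of the geometric series of the Cauchy kernel bounds the
remainder of the Taylor series. *)
Lemma taylor_remainder M N : (forall x, `|f (S (w x))| <= M) ->
  `|f (S z) - \sum_(k < N) S z ^+ k * taylor_coef rho k| <=
  M * (q ^+ N / (1 - q)).
Proof.
move=> fM; have M0 : 0 <= M := le_trans (normr_ge0 _) (fM 0).
have q1 : 0 < 1 - q by rewrite subr_gt0.
apply: quat_qre_le; first by rewrite mulr_ge0// divr_ge0 ?exprn_ge0// ltW.
move=> p.
have i01 : 0 <= (1 : R) <= 1 by rewrite ler01 lexx.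
have cV : continuous (fun x => f (S (w x))).
  move=> x; have rw : slice_ball r I (w x) by have := gam_ball x i01; rewrite gam1.
  exact: (cvg_comp w (fun v => f (S v)) (@cvg_w x) (f_cont rw)).
have kernel :
  circle_int (fun x => qcoord (p * K x) (f (S z))) = tau * qre (p * f (S z)).
  rewrite qreC -circle_int_kernel; congr circle_int; apply/funext => x.
  by rewrite /qcoord mulr1 qreC mulrA.
have coef k : circle_int (fun x => qcoord (p * u x ^+ k) (f (S (w x)))) =
    tau * qre (p * (S z ^+ k * taylor_coef rho k)).
  have cW : continuous (fun x : R => S (cis (- k%:R * x)) * f (S (w x))).
    by move=> x; apply: cvg_quatM (cV x); exact: cvg_cisN.
  rewrite /taylor_coef mulrA -scalerAr qreZ mulrA [tau * _]mulrA.
  rewrite divff ?gt_eqF ?tau_gt0// mul1r.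
  rewrite -[qre _]/(qcoord (p * S z ^+ k) _) qcoord_circle_qint// -circle_intZ.
    congr circle_int; apply/funext => x; rewrite uX /qcoord -qreZ; congr (qre _).
    by rewrite !mulrA -scalerAr -scalerAl.
  by move=> x; apply: cvg_qcoord; exact: cW.
rewrite -(ler_pM2l (@tau_gt0 R)) [p * _]mulrBr mulr_sumr qreB.
rewrite [tau * (_ - _)]mulrBr -kernel -cauchy_circle.
rewrite (circle_int_geometric p N cV).
rewrite (qre_sum N (fun k => p * (S z ^+ k * taylor_coef rho k))).
rewrite mulr_sumr (eq_bigr _ (fun (k : 'I_N) _ => coef k)) addrC addKr.
exact: remainder_le.
Qed.

End at_point.

End taylor.

Section power_series.
Context {R : realType} (I : quaternion R) (HI : imag_units I).
Variables (r : R) (f : quaternion R -> quaternion R).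
Hypotheses (r0 : 0 < r) (fr : slice_regular r f).
Local Notation S := (slice I).

Lemma continuous_sqnorm2 : continuous (@sqnorm2 R).
Proof.
move=> z; apply: cvgD.
  by under eq_fun do rewrite expr2; rewrite expr2; apply: cvgM; exact: cvg_fst.
by under eq_fun do rewrite expr2; rewrite expr2; apply: cvgM; exact: cvg_snd.
Qed.

Lemma continuous_on_slice v : slice_ball r I v ->
  {for v, continuous (fun z => f (S z))}.
Proof.
move=> rv; have [fd _] := fr.
exact: (cvg_comp S f (@continuous_slice R I v)
  (differentiable_continuous (fd _ rv))).
Qed.

Lemma compact_disc (s : R) : compact [set z : R * R | sqnorm2 z <= s ^+ 2].
Proof.
have cK : compact (`[- `|s|, `|s|] `*` `[- `|s|, `|s|] : set (R * R)).
  by apply: compact_setX; exact: segment_compact.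
apply: subclosed_compact cK _.
  rewrite (_ : [set z | _] = @sqnorm2 R @^-1` [set t | t <= s ^+ 2]) //.
  by apply: preimage_closed; [move=> z _; exact: continuous_sqnorm2|exact: closed_le].
move=> [x y]; rewrite /sqnorm2/= => xys; split; rewrite /= in_itv/= -ler_norml.
  rewrite -(ler_pXn2r (n := 2)) ?nnegrE// !real_normK ?num_real//.
  by rewrite (le_trans _ xys)// lerDl sqr_ge0.
rewrite -(ler_pXn2r (n := 2)) ?nnegrE// !real_normK ?num_real//.
by rewrite (le_trans _ xys)// lerDr sqr_ge0.
Qed.

Lemma bounded_on_disc (s : R) : 0 < s < r ->
  exists2 M, 0 <= M & forall z, `|S z| <= s -> `|f (S z)| <= M.
Proof.
move=> /andP[s0 sr].
pose D := [set z : R * R | sqnorm2 z <= s ^+ 2].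
have DE z : `|S z| <= s -> D z.
  by move=> zs; rewrite /D/= -(sqr_norm_slice HI) ler_pXn2r ?nnegrE// ltW.
have : compact ((fun z => `|f (S z)|) @` D).
  apply: continuous_compact; last exact: compact_disc.
  apply/continuous_in_subspaceT => z; rewrite inE /D/= => zs.
  have rz : slice_ball r I z.
    rewrite slice_ballE//= (le_lt_trans zs)//.
    by rewrite ltr_pXn2r ?nnegrE// ltW// (lt_trans s0).
  apply: cvg_norm; exact: continuous_on_slice.
move=> /compact_bounded[M [Mr hM]]; exists (`|M| + 1) => [|z /DE Dz].
  by rewrite addr_ge0.
have := hM (`|M| + 1); rewrite (le_lt_trans (ler_norm M))// ?ltrDl// => /(_ isT).
by move=> /(_ `|f (S z)|) h; rewrite -normr_id; apply: h; exists z.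
Qed.

Local Notation coef := (taylor_coef I f).

Lemma taylor_estimate (rho : R) : 0 < rho < r ->
  exists2 M, 0 <= M & forall z N, `|S z| < rho ->
  `|f (S z) - \sum_(k < N) S z ^+ k * coef rho k| <=
  M * ((`|S z| / rho) ^+ N / (1 - `|S z| / rho)).
Proof.
move=> rr; have [M M0 fM] := bounded_on_disc rr; have /andP[rho0 rho_r] := rr.
exists M => // z N zrho; apply: (taylor_remainder HI fr rho0 rho_r zrho) => x.
apply: fM; rewrite slice_scale normrZ norm_slice_cis// mulr1 gtr0_norm//.
Qed.

(** Two expansions agree up to [O(x ^+ n.+1)] along the real axis, which forces
their coefficients to agree one after the other. *)
Lemma taylor_coef_unique (rho s : R) n : 0 < rho < r -> 0 < s < r ->
  coef rho n = coef s n.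
Proof.
move=> rr sr; elim/ltn_ind: n => n IH.
have [M M0 hM] := taylor_estimate rr; have [L L0 hL] := taylor_estimate sr.
have /andP[rho0 _] := rr; have /andP[s0 _] := sr.
pose C := M * (2 / rho ^+ n.+1) + L * (2 / s ^+ n.+1).
have C0 : 0 <= C by rewrite addr_ge0// mulr_ge0// divr_ge0// exprn_ge0// ltW.
have bound (K t x : R) : 0 <= K -> 0 < t -> 0 < x -> x <= t / 2 ->
    K * ((x / t) ^+ n.+1 / (1 - x / t)) <= K * (2 / t ^+ n.+1) * x ^+ n.+1.
  move=> K0 t0 x0 xt; rewrite -[leRHS]mulrA ler_wpM2l// expr_div_n.
  have -> : 2 / t ^+ n.+1 * x ^+ n.+1 = x ^+ n.+1 / t ^+ n.+1 * 2.
    by rewrite mulrC mulrA mulrAC.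
  rewrite ler_wpM2l ?divr_ge0 ?exprn_ge0 ?(ltW x0) ?(ltW t0)//.
  have xt2 : x / t <= 2^-1 by rewrite ler_pdivrMr// mulrC.
  by rewrite -[leRHS]invrK lef_pV2 ?posrE//; lra.
pose d := Num.min (rho / 2) (s / 2).
have d0 : 0 < d by rewrite lt_min !divr_gt0.
suff small : forall x, 0 < x -> x <= d -> `|coef rho n - coef s n| <= C * x.
  apply/eqP; rewrite -subr_eq0 -normr_eq0 eq_le normr_ge0 andbT.
  apply/ler_addgt0Pr => e e0; rewrite add0r.
  have C1 : 0 < C + 1 by rewrite ltr_wpDl.
  pose x := Num.min d (e / (C + 1)).
  have x0 : 0 < x by rewrite lt_min d0 divr_gt0.
  apply: (le_trans (small x x0 _)); first by rewrite ge_min lexx.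
  apply: (@le_trans _ _ (C * (e / (C + 1)))).
    by rewrite ler_wpM2l// ge_min lexx orbT.
  by rewrite mulrA ler_pdivrMr// mulrC ler_pM2l// lerDl.
move=> x x0; rewrite le_min => /andP[xr xs].
have nSx : `|S (x, 0)| = x.
  by rewrite slice_real normrZ norm_quat1 mulr1 gtr0_norm.
have xrho : x < rho by rewrite (le_lt_trans xr)// ltr_pdivrMr// ltr_pMr// ltr1n.
have xs' : x < s by rewrite (le_lt_trans xs)// ltr_pdivrMr// ltr_pMr// ltr1n.
have := hM (x, 0) n.+1; have := hL (x, 0) n.+1; rewrite nSx => /(_ xs') hs /(_ xrho) hr.
have {}hr := le_trans hr (bound _ _ _ M0 rho0 x0 xr).
have {}hs := le_trans hs (bound _ _ _ L0 s0 x0 xs).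
rewrite -(ler_pM2l (exprn_gt0 n x0)).
have -> : x ^+ n * (C * x) = M * (2 / rho ^+ n.+1) * x ^+ n.+1 +
    L * (2 / s ^+ n.+1) * x ^+ n.+1 by rewrite -mulrDl -/C exprS; ring.
apply: le_trans (lerD hr hs); apply: le_trans (ler_normB _ _).
have E (A B D : quaternion R) : A - B - (A - D) = D - B.
  by rewrite opprB addrC addrA subrK.
have key (A B : quaternion R) :
    `|S (x, 0) ^+ n * A - S (x, 0) ^+ n * B| = x ^+ n * `|B - A|.
  by rewrite -mulrBr norm_quatM norm_quatX nSx distrC.
rewrite E -sumrB big_ord_recr/= big1 ?add0r.
  by rewrite key.
by move=> k _; rewrite (IH k (ltn_ord k)) subrr.
Qed.

Lemma power_series_expansion : exists a : nat -> quaternion R,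
  forall s, 0 < s < r -> exists C q, [/\ 0 <= C, 0 <= q < 1 &
    forall z N, `|S z| <= s ->
      `|f (S z) - \sum_(k < N) S z ^+ k * a k| <= C * q ^+ N].
Proof.
exists (coef (r / 2)) => s /andP[s0 sr].
have r2 : 0 < r / 2 < r by lra.
pose rho := (s + r) / 2.
have rr : 0 < rho < r by rewrite /rho; lra.
have srho : s < rho by rewrite /rho; lra.
have /andP[rho0 _] := rr.
have [M M0 hM] := taylor_estimate rr.
have q1 : s / rho < 1 by rewrite ltr_pdivrMr// mul1r.
exists (M / (1 - s / rho)), (s / rho); split.
- by rewrite divr_ge0// subr_ge0 ltW.
- by rewrite q1 divr_ge0// ltW.
move=> z N zs; under eq_bigr do rewrite (taylor_coef_unique _ r2 rr).
apply: (le_trans (hM z N (le_lt_trans zs srho))).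
rewrite -mulrA ler_wpM2l// [leRHS]mulrC.
have zq : `|S z| / rho <= s / rho by rewrite ler_pM2r ?invr_gt0.
have z0 : 0 <= `|S z| / rho by rewrite divr_ge0// ltW.
have z1 := le_lt_trans zq q1.
apply: ler_pM.
- exact: exprn_ge0.
- by rewrite invr_ge0 subr_ge0 ltW.
- by rewrite lerXn2r// nnegrE (le_trans z0).
- by rewrite lef_pV2 ?posrE ?subr_gt0// lerD2l lerN2.
Qed.

End power_series.

(** * The weighted measure on a slice *)

Section weight.
Context {R : realType} (I : quaternion R) (HI : imag_units I).
Variables (r alpha : R).
Hypotheses (r0 : 0 < r) (alpha0 : 0 < alpha).
Local Notation mu2 := (lebesgue2 R).
Local Notation S := (slice I).
Local Notation D s := (slice_ball s I).

Definition weight (z : R * R) : R := bergman_weight alpha r (S z).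

Lemma weightE z : weight z =
  alpha / (pi * r ^+ 2) * (1 - sqnorm2 z / r ^+ 2) `^ (alpha - 1).
Proof. by rewrite /weight /bergman_weight sqr_norm_slice. Qed.

Lemma weight_ge0 z : 0 <= weight z.
Proof.
rewrite weightE mulr_ge0 ?powR_ge0// divr_ge0 ?(ltW alpha0)//.
by rewrite mulr_ge0 ?pi_ge0 ?sqr_ge0.
Qed.

Lemma measurable_slice_ball s : 0 < s -> measurable (D s : set (plane R)).
Proof.
move=> s0; rewrite slice_ballE//.
rewrite (_ : [set z | _] = @sqnorm2 R @^-1` [set t | t < s ^+ 2])//.
apply: open_measurable2; apply: open_comp; last exact: open_lt.
by move=> z _; exact: continuous_sqnorm2.
Qed.

Lemma measurable_weight (E : set (plane R)) : measurable_fun E (weight : plane R -> R).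
Proof.
apply: measurable_funTS; rewrite (_ : weight = fun z =>
  alpha / (pi * r ^+ 2) * (1 - sqnorm2 z / r ^+ 2) `^ (alpha - 1)); last first.
  by apply/funext => z; exact: weightE.
apply: measurable_funM => //; apply: (measurableT_comp (measurable_powR _)).
apply: measurable_funB => //; apply: measurable_funM => //.
exact: measurable_sqnorm2.
Qed.

Definition moment n : R :=
  n`!%:R * r ^+ (2 * n) * Gamma (alpha + 1) / Gamma (n%:R + alpha + 1).

(** In the radial variable the integral is a beta integral, which obeys the
same recursion in [n] as the quotient of values of [Gamma]. *)
Lemma integral_moment n :
  (\int[mu2]_(z in D r) (sqnorm2 z ^+ n * weight z)%:E = (moment n)%:E)%E.
Proof.
pose c := r ^+ 2; have c0 : 0 < c by rewrite exprn_gt0.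
have radial m : (\int[lebesgue_measure]_(t in `[0%R, c[) (radial_density c alpha m t)%:E =
    (c / alpha * moment m)%:E)%E.
  elim: m => [|m IH].
    rewrite radial_integral0// /moment fact0 muln0 expr0 add0r mul1r mul1r.
    by rewrite divff ?mulr1// gt_eqF// Gamma_gt0// ltrDr.
  rewrite (radial_integralS c0 alpha0 IH); congr EFin.
  have ma1 : 1 < m%:R + alpha + 1 by rewrite ltrDr ltr_wpDl.
  have -> : moment m.+1 = c * m.+1%:R / (m.+1%:R + alpha) * moment m.
    rewrite /moment (_ : m.+1%:R + alpha + 1 = m%:R + alpha + 1 + 1); last first.
      by rewrite -natr1; ring.
    rewrite (GammaS ma1) factS natrM mulnS exprD -/c -natr1.
    have -> : m%:R + 1 + alpha = m%:R + alpha + 1 by ring.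
    by rewrite invfM; ring.
  by ring.
have DE : D r = @sqnorm2 R @^-1` `[0, c[%classic.
  rewrite slice_ballE//; apply/seteqP; split => z /=; rewrite in_itv/= sqnorm2_ge0//.
pose g t := alpha / (pi * c) * radial_density c alpha n t.
transitivity (\int[mu2]_(z in @sqnorm2 R @^-1` `[0%R, c[) (g (sqnorm2 z))%:E)%E.
  rewrite -DE; apply: eq_integral => z _; congr EFin.
  by rewrite weightE /g /radial_density -/c; ring.
have k0 : 0 <= alpha / (pi * c) by rewrite divr_ge0 ?mulr_ge0 ?pi_ge0// ltW.
rewrite integral_sqnorm2//; last 3 first.
- by move=> t /=; rewrite !in_itv/= => /andP[->].
- by apply: measurable_funM => //; exact: measurable_radial_density.
- move=> t /=; rewrite in_itv/= => /andP[t0 _]; rewrite mulr_ge0//.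
  exact: radial_density_ge0.
under eq_integral do rewrite EFinM.
rewrite ge0_integralZl//=; last 2 first.
- by apply/measurable_EFinP; exact: measurable_radial_density.
- by move=> t /=; rewrite in_itv/= lee_fin => /andP[t0 _]; exact: radial_density_ge0.
rewrite radial -!EFinM /g; congr EFin.
move: (pi : R) (pi_gt0 R) => p p0; field.
by rewrite !gt_eqF.
Qed.

Lemma weight_integrable s : 0 < s <= r ->
  mu2.-integrable (D s : set (plane R)) (EFin \o weight).
Proof.
move=> /andP[s0 sr].
have ir : mu2.-integrable (D r : set (plane R)) (EFin \o weight).
  apply/integrableP; split.
    by apply/measurable_EFinP; exact: measurable_weight.
  rewrite (_ : (\int[_]_(z in _) _)%E = (moment 0)%:E) ?ltry//.
  rewrite -integral_moment; apply: eq_integral => z _.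
  by rewrite expr0 mul1r gee0_abs// lee_fin weight_ge0.
apply: (integrableS _ _ _ ir); [exact: measurable_slice_ball|
  exact: measurable_slice_ball|].
by move=> z /= zs; rewrite /slice_ball/qball/= (lt_le_trans zs).
Qed.

Lemma bounded_integrable s (h : R * R -> R) C : 0 < s <= r ->
  (forall z, D s z -> {for z, continuous h}) ->
  (forall z, D s z -> `|h z| <= C) ->
  mu2.-integrable (D s : set (plane R)) (EFin \o (fun z => h z * weight z)).
Proof.
move=> sr ch hC; have /andP[s0 _] := sr; have mD := measurable_slice_ball s0.
have ic := integrableZl mD C (weight_integrable sr).
apply: (le_integrable mD _ _ ic).
  apply/measurable_EFinP; apply: measurable_funM; last exact: measurable_weight.
  exact: continuous_at_measurable.
move=> z Dz; rewrite /= lee_fin (normrM (h z)) (normrM C) (ger0_norm (weight_ge0 z)).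
by rewrite ler_wpM2r ?weight_ge0// (le_trans (hC z Dz))// ler_norm.
Qed.

Lemma continuous_integrable s (h : R * R -> R) : 0 < s <= r -> continuous h ->
  mu2.-integrable (D s : set (plane R)) (EFin \o (fun z => h z * weight z)).
Proof.
move=> sr ch.
have : compact (h @` [set z : R * R | sqnorm2 z <= s ^+ 2]).
  apply: continuous_compact; last exact: compact_disc.
  exact: continuous_subspaceT.
move=> /compact_bounded[M [Mr hM]].
apply: (@bounded_integrable s h (M + 1)) => // [z _|z Dz]; first exact: ch.
apply: (hM (M + 1)).
  by rewrite ltrDl.
exists z => //=; have /andP[s0 _] := sr; move: Dz; rewrite slice_ballE//=.
exact: ltW.
Qed.

End weight.

(** * Orthogonality of the powers on every disc *)

Section orthogonality.
Context {R : realType} (I : quaternion R) (HI : imag_units I).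
Variables (r alpha : R).
Hypotheses (r0 : 0 < r) (alpha0 : 0 < alpha).
Local Notation mu2 := (lebesgue2 R).
Local Notation S := (slice I).
Local Notation D s := (slice_ball s I).
Local Notation W := (weight I r alpha).

Lemma cvg_power n (z : R * R) : (fun y => S y ^+ n) @ z --> S z ^+ n.
Proof. by apply: cvg_quatX; exact: continuous_slice. Qed.

Definition herm j k z : quaternion R := qconj (S z ^+ j) * S z ^+ k.

Lemma cvg_herm j k (z : R * R) : herm j k @ z --> herm j k z.
Proof. by apply: cvg_quatM; [apply: cvg_qconj; exact: cvg_power|exact: cvg_power]. Qed.

Lemma herm_integrable s p j k : 0 < s <= r -> mu2.-integrable (D s : set (plane R))
  (EFin \o (fun z => qcoord p (herm j k z) * W z)).
Proof.
move=> sr; apply: continuous_integrable => // z.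
by apply: cvg_qcoord; exact: cvg_herm.
Qed.

(** The rotation of angle [t] multiplies [herm j k] by [herm j k (cis t)]. For
a right angle divided by the distance of [j] and [k], this factor is [I] or
[- I], a square root of [-1]. *)
Lemma herm_cis_imag j k : j != k -> exists2 t : R, 0 <= cos t &
  exists2 u : quaternion R, u * u = -1 &
    (forall z, u * S z = S z * u) /\ herm j k (cis t) = u.
Proof.
move=> jk; pose d := `|j - k|%N.
have d0 : (0 < d)%N by rewrite lt0n distn_eq0.
exists (d%:R^-1 * (pi / 2)).
  have pi0 := pi_gt0 R; apply: cos_ge0_pihalf.
  have d1 : d%:R^-1 <= 1 :> R by rewrite invf_le1 ?ler1n ?ltr0n.
  have dp : 0 <= d%:R^-1 :> R by rewrite invr_ge0.
  by apply/andP; split; nra.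
have Ed : S (cis (d%:R^-1 * (pi / 2))) ^+ d = I.
  rewrite slice_cisX// mulrA divff ?pnatr_eq0 -?lt0n// mul1r.
  by rewrite /cis cos_pihalf sin_pihalf slice_imag.
set E := S (cis _) in Ed *.
have nE n : `|E ^+ n| = 1 by rewrite norm_quatX norm_slice_cis// expr1n.
have commI z : I * S z = S z * I.
  by have := slice_comm HI (0, 1) z; rewrite slice_imag.
have [ltjk|] := ltnP j k.
  exists I; first exact: imag_unit_sqr.
  split=> //; rewrite /herm -/E -(subnKC (ltnW ltjk)) exprD mulrA mulqconj nE.
  by rewrite expr1n scale1r mul1r -Ed /d distnEr// ltnW.
move=> lekj.
have nI : qconj I = - I.
  have [I0 _] := imag_unitP HI.
  by apply: quat_ext; rewrite /= ?I0 ?oppr0.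
exists (- I); first by rewrite mulrNN imag_unit_sqr.
split=> [z|]; first by rewrite mulNr mulrN commI.
rewrite /herm -/E -(subnKC lekj) exprD qconjM -mulrA mulqconj nE.
by rewrite expr1n scale1r mulr1 -nI -Ed /d distnEl.
Qed.

Lemma mu2_preserving_integral (T : plane R -> plane R) (E : set (plane R))
    (h : plane R -> R) : mu2_preserving T -> measurable E -> T @^-1` E = E ->
  measurable_fun setT h -> mu2.-integrable E (EFin \o h \o T) ->
  \int[mu2]_(z in E) h (T z) = \int[mu2]_(z in E) h z.
Proof.
move=> [mT pT] mE TE mh ih; congr fine.
have mh' : measurable_fun setT (EFin \o h) by exact/measurable_EFinP.
have ih' : mu2.-integrable (T @^-1` E) ((EFin \o h) \o T) by rewrite TE.
transitivity (\int[mu2]_(z in T @^-1` E) ((EFin \o h) \o T) z)%E.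
  by rewrite TE.
rewrite -(integral_pushforward mT mh' ih' mE).
apply: eq_measure_integral => A mA AE.
exact: pT.
Qed.

Lemma rotation_cmul (t : R) (z : R * R) : rotation (cos t) (sin t) z = cmul (cis t) z.
Proof. by rewrite /rotation/cmul/= [sin t * _ + _]addrC. Qed.

(** Rotating twice by the angle of [herm_cis_imag] preserves the integral and
reverses its sign. *)
Lemma herm_orthogonal s p j k : 0 < s <= r -> j != k ->
  \int[mu2]_(z in D s) (qcoord p (herm j k z) * W z) = 0.
Proof.
move=> sr jk; have [t t0 [u uu [uS Eu]]] := herm_cis_imag jk.
have /andP[s0 _] := sr.
pose J p := \int[mu2]_(z in D s) (qcoord p (herm j k z) * W z).
pose T : plane R -> plane R := rotation (cos t) (sin t).
have ST z : S (T z) = S (cis t) * S z by rewrite /T rotation_cmul sliceM.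
have nT z : sqnorm2 (T z) = sqnorm2 z.
  by rewrite -!(sqr_norm_slice HI) ST norm_quatM norm_slice_cis// mul1r.
have hermT z : herm j k (T z) = herm j k z * u.
  have uX n : u * S z ^+ n = S z ^+ n * u by apply: commrX; exact: uS.
  rewrite /herm ST !exprMn_comm; try exact: slice_comm.
  rewrite qconjM -mulrA [X in _ * X]mulrA -/(herm j k (cis t)) Eu uX.
  by rewrite mulrA.
have Jrot q : J q = J (u * q).
  rewrite {1}/J -(@mu2_preserving_integral T).
  - apply: eq_Rintegral => z _; congr (_ * _); last by rewrite !weightE// nT.
    by rewrite hermT /qcoord mulrA qreC mulrA.
  - apply: mu2_preserving_rotation => //; exact: cos2Dsin2.
  - exact: measurable_slice_ball.
  - by rewrite slice_ballE//; apply/seteqP; split => z /=; rewrite nT.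
  - apply: measurable_funM; last exact: measurable_weight.
    apply: continuous_at_measurable => // z _.
    by apply: cvg_qcoord; exact: cvg_herm.
  - apply: eq_integrable (herm_integrable (u * q) j k sr).
      exact: measurable_slice_ball.
    move=> z _ /=; rewrite hermT !weightE// nT; congr ((_ * _)%:E).
    by rewrite /qcoord [in RHS]mulrA [in RHS]qreC [in RHS]mulrA.
suff : J p = - J p by rewrite -/(J p); lra.
rewrite [LHS]Jrot [LHS]Jrot mulrA uu mulN1r.
transitivity (-1 * J p); last by rewrite mulN1r.
rewrite /J -RintegralZl//.
- by apply: eq_Rintegral => z _; rewrite /qcoord mulNr qreN !mulNr mul1r.
- exact: measurable_slice_ball.
- exact: herm_integrable.
Qed.

End orthogonality.

(** * Density of the polynomials *)

Section density.
Context {R : realType} (I : quaternion R) (HI : imag_units I).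
Variables (r alpha : R).
Hypotheses (r0 : 0 < r) (alpha0 : 0 < alpha).
Local Notation mu2 := (lebesgue2 R).
Local Notation S := (slice I).
Local Notation D s := (slice_ball s I).
Local Notation W := (weight I r alpha).

Lemma qconjD (p q : quaternion R) : qconj (p + q) = qconj p + qconj q.
Proof. by apply: quat_ext; rewrite //= opprD. Qed.

Lemma qre_conjDl (p q s : quaternion R) :
  qre (qconj (p + q) * s) = qre (qconj p * s) + qre (qconj q * s).
Proof. by rewrite -qreD -mulrDl qconjD. Qed.

Lemma qre_conjDr (p q s : quaternion R) :
  qre (qconj s * (p + q)) = qre (qconj s * p) + qre (qconj s * q).
Proof. by rewrite -qreD -mulrDr. Qed.

Definition spoly (a : nat -> quaternion R) N z : quaternion R :=
  \sum_(k < N) S z ^+ k * a k.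

Lemma spolyS a N z : spoly a N.+1 z = spoly a N z + S z ^+ N * a N.
Proof. by rewrite /spoly big_ord_recr. Qed.

Lemma cvg_monomial (b : quaternion R) k (z : R * R) :
  (fun y => S y ^+ k * b) @ z --> S z ^+ k * b.
Proof. by apply: cvg_quatM; [exact: cvg_power|exact: cvg_cst]. Qed.

Lemma cvg_spoly a N (z : R * R) : spoly a N @ z --> spoly a N z.
Proof.
elim: N => [|N IH].
  rewrite (_ : spoly a 0 = fun=> 0); first exact: cvg_cst.
  by apply/funext => y; rewrite /spoly big_ord0.
rewrite (_ : spoly a N.+1 = fun y => spoly a N y + S y ^+ N * a N).
  by apply: cvgD => //; exact: cvg_monomial.
by apply/funext => y; exact: spolyS.
Qed.

Lemma cvg_qre_herm (u v : R * R -> quaternion R) (z : R * R) :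
  u @ z --> u z -> v @ z --> v z ->
  {for z, continuous (fun y => qre (qconj (u y) * v y))}.
Proof. by move=> cu cv; apply: cvg_qcoord2 cv; exact: cvg_qconj. Qed.

Lemma spoly_power_orthogonal s a b N k : 0 < s <= r -> (N <= k)%N ->
  \int[mu2]_(z in D s) (qre (qconj (spoly a N z) * (S z ^+ k * b)) * W z) = 0.
Proof.
move=> sr; have /andP[s0 _] := sr; have mD := measurable_slice_ball HI s0.
elim: N => [_|N IH Nk].
  transitivity (\int[mu2]_(z in D s) 0); last by rewrite Rintegral_cst// mul0r.
  apply: eq_Rintegral => z _; rewrite /spoly big_ord0.
  by rewrite (_ : qconj 0 = 0) ?mul0r//; apply: quat_ext; rewrite //= oppr0.
transitivity (\int[mu2]_(z in D s)
   (qre (qconj (spoly a N z) * (S z ^+ k * b)) * W z +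
    qcoord (b * qconj (a N)) (herm I N k z) * W z)).
  apply: eq_Rintegral => z _; rewrite spolyS qre_conjDl [LHS]mulrDl.
  congr (_ + _ * _); rewrite qconjM /qcoord /herm mulrA [LHS]qreC.
  by rewrite !mulrA.
rewrite RintegralD//.
- by rewrite IH ?(ltnW Nk)// herm_orthogonal ?addr0// neq_ltn Nk.
- apply: continuous_integrable => // z.
  by apply: cvg_qre_herm; [exact: cvg_spoly|exact: cvg_monomial].
- exact: herm_integrable.
Qed.

Lemma spoly_orthogonal s a N M : 0 < s <= r -> (N <= M)%N ->
  \int[mu2]_(z in D s)
    (qre (qconj (spoly a N z) * (spoly a M z - spoly a N z)) * W z) = 0.
Proof.
move=> sr; have /andP[s0 _] := sr; have mD := measurable_slice_ball HI s0.
move=> /subnKC <-; elim: (M - N)%N => [|m IH].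
  transitivity (\int[mu2]_(z in D s) 0); last by rewrite Rintegral_cst// mul0r.
  by apply: eq_Rintegral => z _; rewrite addn0 subrr mulr0 mul0r.
transitivity (\int[mu2]_(z in D s)
   (qre (qconj (spoly a N z) * (spoly a (N + m) z - spoly a N z)) * W z +
    qre (qconj (spoly a N z) * (S z ^+ (N + m) * a (N + m)%N)) * W z)).
  apply: eq_Rintegral => z _; rewrite -[RHS]mulrDl -qre_conjDr.
  by rewrite addnS spolyS addrAC.
rewrite RintegralD//.
- by rewrite IH spoly_power_orthogonal ?addr0// leq_addr.
- apply: continuous_integrable => // z; apply: cvg_qre_herm; first exact: cvg_spoly.
  by apply: cvgB; exact: cvg_spoly.
- apply: continuous_integrable => // z.
  by apply: cvg_qre_herm; [exact: cvg_spoly|exact: cvg_monomial].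
Qed.

Section expansion.
Variables (f : quaternion R -> quaternion R) (a : nat -> quaternion R).
Hypothesis fr : slice_regular r f.
Hypothesis fa : forall s, 0 < s < r -> exists C q, [/\ 0 <= C, 0 <= q < 1 &
    forall z N, `|S z| <= s -> `|f (S z) - spoly a N z| <= C * q ^+ N].

Let F z := f (S z).
Let err N z := F z - spoly a N z.

Let cvg_F z : D r z -> F @ z --> F z.
Proof. exact: continuous_on_slice. Qed.

Let cvg_err N z : D r z -> err N @ z --> err N z.
Proof. by move=> rz; apply: cvgB; [exact: cvg_F|exact: cvg_spoly]. Qed.

Let sub_ball s z : s <= r -> D s z -> D r z.
Proof. by move=> sr; rewrite /slice_ball/qball/= => /lt_le_trans; apply. Qed.

Let pair_integrable s (u v : R * R -> quaternion R) (A B : R) : 0 < s <= r ->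
  (forall z, D r z -> u @ z --> u z) -> (forall z, D r z -> v @ z --> v z) ->
  (forall z, D s z -> `|u z| <= A) -> (forall z, D s z -> `|v z| <= B) ->
  mu2.-integrable (D s : set (plane R))
    (EFin \o (fun z => qre (qconj (u z) * v z) * W z)).
Proof.
move=> sr cu cv uA vB; have /andP[_ s_r] := sr.
apply: (@bounded_integrable R I HI r alpha r0 alpha0 s _ (A * B)) => // z Dz.
  have rz := sub_ball s_r Dz.
  by apply: cvg_qre_herm; [exact: cu|exact: cv].
rewrite (le_trans (le_qre_norm _))// norm_quatM norm_qconj.
by rewrite ler_pM//; [exact: uA|exact: vB].
Qed.

(** On a disc of radius less than [r], [f] is a uniform limit of longer partial
sums, whose differences with [spoly a N] are orthogonal to [spoly a N]. *)
Lemma spoly_error_orthogonal s N : 0 < s < r ->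
  \int[mu2]_(z in D s) (qre (qconj (spoly a N z) * err N z) * W z) = 0.
Proof.
move=> sr; have /andP[s0 s_r] := sr.
have sr' : 0 < s <= r by rewrite s0 ltW.
have mD := measurable_slice_ball HI s0.
have [C [q [C0 q01 faN]]] := fa sr; have /andP[q0 _] := q01.
have [B B0 FB] := bounded_on_disc HI r0 fr sr.
have Ds z : D s z -> `|S z| <= s by rewrite /slice_ball/qball/= => /ltW.
have errB M z : D s z -> `|err M z| <= C * q ^+ M by move=> /Ds; exact: faN.
have PB z : D s z -> `|spoly a N z| <= B + C * q ^+ N.
  move=> Dz; rewrite (_ : spoly a N z = F z - err N z).
    by rewrite (le_trans (ler_normB _ _))// lerD ?errB// FB// Ds.
  by rewrite /err opprB addrC subrK.
set X := \int[mu2]_(z in D s) _.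
pose w := \int[mu2]_(z in D s) W z.
have bound M : `|X| <= (B + C * q ^+ N) * C * q ^+ N * w * q ^+ M.
  have NM : (N <= N + M)%N by rewrite leq_addr.
  have iE : mu2.-integrable (D s : set (plane R))
      (EFin \o (fun z => qre (qconj (spoly a N z) * err (N + M)%N z) * W z)).
    apply: (pair_integrable (A := B + C * q ^+ N) (B := C * q ^+ (N + M))) => //.
    - by move=> z _; exact: cvg_spoly.
    - by move=> z; exact: cvg_err.
    - by move=> z; exact: errB.
  have -> : X = \int[mu2]_(z in D s) (qre (qconj (spoly a N z) * err (N + M)%N z) * W z).
    rewrite -[RHS]addr0 -(spoly_orthogonal a sr' NM) -RintegralD//.
      apply: eq_Rintegral => z _; rewrite -[RHS]mulrDl -qre_conjDr.
      by rewrite /err addrA subrK.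
    apply: continuous_integrable => // z; apply: cvg_qre_herm; first exact: cvg_spoly.
    by apply: cvgB; exact: cvg_spoly.
  apply: (le_trans (le_normr_Rintegral mD iE)).
  have -> : (B + C * q ^+ N) * C * q ^+ N * w * q ^+ M =
      (B + C * q ^+ N) * (C * q ^+ (N + M)) * w by rewrite exprD; ring.
  rewrite /w -RintegralZl//; last exact: weight_integrable.
  apply: le_Rintegral => //.
  - exact: (integrable_norm iE).
  - exact: (integrableZl mD _ (weight_integrable HI r0 alpha0 sr')).
  move=> z Dz; rewrite normrM (ger0_norm (weight_ge0 HI r alpha0 z)).
  rewrite ler_wpM2r ?weight_ge0//.
  rewrite (le_trans (le_qre_norm _))// norm_quatM norm_qconj.
  by rewrite ler_pM//; [exact: PB|exact: errB].
apply/eqP; rewrite -normr_eq0 eq_le normr_ge0 andbT.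
exact: geometric_le0 q01 bound.
Qed.

Let sq_integrable s (u : R * R -> quaternion R) (A : R) : 0 < s <= r ->
  (forall z, D r z -> u @ z --> u z) -> (forall z, D s z -> `|u z| <= A) ->
  mu2.-integrable (D s : set (plane R)) (EFin \o (fun z => `|u z| ^+ 2 * W z)).
Proof.
move=> sr cu uA; have := pair_integrable sr cu cu uA uA.
rewrite (_ : (fun z => qre _ * _) = fun z => `|u z| ^+ 2 * W z)//.
by apply/funext => z; rewrite qre_qconjM.
Qed.

Lemma spoly_pythagoras s N : 0 < s < r ->
  [/\ mu2.-integrable (D s : set (plane R)) (EFin \o (fun z => `|F z| ^+ 2 * W z)),
      mu2.-integrable (D s : set (plane R)) (EFin \o (fun z => `|err N z| ^+ 2 * W z)) &
  \int[mu2]_(z in D s) (`|F z| ^+ 2 * W z) =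
  \int[mu2]_(z in D s) (`|spoly a N z| ^+ 2 * W z) +
  \int[mu2]_(z in D s) (`|err N z| ^+ 2 * W z)].
Proof.
move=> sr; have /andP[s0 s_r] := sr.
have sr' : 0 < s <= r by rewrite s0 ltW.
have mD := measurable_slice_ball HI s0.
have [C [q [C0 q01 faN]]] := fa sr.
have [B B0 FB] := bounded_on_disc HI r0 fr sr.
have Ds z : D s z -> `|S z| <= s by rewrite /slice_ball/qball/= => /ltW.
have errB z : D s z -> `|err N z| <= C * q ^+ N by move=> /Ds; exact: faN.
have FB' z : D s z -> `|F z| <= B by move=> /Ds; exact: FB.
have PB z : D s z -> `|spoly a N z| <= B + C * q ^+ N.
  move=> Dz; rewrite (_ : spoly a N z = F z - err N z).
    by rewrite (le_trans (ler_normB _ _))// lerD ?errB// FB'.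
  by rewrite /err opprB addrC subrK.
have cP z : D r z -> spoly a N @ z --> spoly a N z by move=> _; exact: cvg_spoly.
have iF := sq_integrable sr' (fun z Dz => @cvg_F z Dz) FB'.
have iE := sq_integrable sr' (fun z Dz => @cvg_err N z Dz) errB.
have iP := sq_integrable sr' cP PB.
have iX := pair_integrable sr' cP (fun z Dz => @cvg_err N z Dz) PB errB.
split => //; rewrite -RintegralD// -[RHS]addr0.
rewrite -(mulr0 2) -(spoly_error_orthogonal N sr) -RintegralZl// -RintegralD//.
- apply: eq_Rintegral => z _; rewrite -mulrDl mulrA -mulrDl; congr (_ * _).
  by rewrite -sqr_norm_quatD /err addrC subrK.
- rewrite (_ : EFin \o _ = fun z => ((`|spoly a N z| ^+ 2 * W z)%:E +
      (`|err N z| ^+ 2 * W z)%:E)%E); first exact: integrableD.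
  by apply/funext => z; rewrite /= EFinD.
- exact: (integrableZl mD 2 iX).
Qed.

Let radius n := inner_end r n.

Let radius_itv n : 0 < radius n < r. Proof. exact: inner_end_itv. Qed.

Let cvg_integral_radius (h : R * R -> R) :
  measurable_fun (D r : set (plane R)) (h : plane R -> R) ->
  (forall z, 0 <= h z) ->
  (\int[mu2]_(z in D (radius n)) (h z)%:E @[n --> \oo] -->
   \int[mu2]_(z in D r) (h z)%:E)%E.
Proof.
move=> mh h0; have DU : D r = \bigcup_n D (radius n).
  apply/seteqP; split => z; last first.
    by move=> [n _]; apply: sub_ball; have /andP[_ /ltW] := radius_itv n.
  rewrite /slice_ball/qball/= => zr.
  have := @cvg_inner_end R r => /cvgrPdist_lt/(_ (r - `|S z|)).
  rewrite subr_gt0 => /(_ zr)[N _ /(_ N)/= /(_ (leqnn _))].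
  move=> Nz; exists N => //=; move: Nz; have /andP[_ Nr] := radius_itv N.
  by rewrite gtr0_norm ?subr_gt0// ltrD2l ltrN2.
rewrite DU; apply: ge0_nondecreasing_set_cvg_integral.
- move=> m n mn; apply/subsetPset => z; rewrite /slice_ball/qball/= => /lt_le_trans.
  apply; rewrite /radius /inner_end lerD2l lerN2 ler_pM2l//.
  by rewrite lef_pV2 ?posrE// ler_nat.
- by move=> n; apply: measurable_slice_ball => //; have /andP[] := radius_itv n.
- move=> n; apply/measurable_EFinP; apply: measurable_funS mh.
    exact: measurable_slice_ball.
  by move=> z; apply: sub_ball; have /andP[_ /ltW] := radius_itv n.
- by move=> n z _; rewrite lee_fin.
Qed.

(** The partial sums approximate [f] in the mean: most of the mass of [f] lies
on a smaller disc, on which they converge uniformly, and by orthogonality the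
mass that they may carry near the boundary is at most that of [f]. *)
Lemma spoly_mean_approximation (e : R) : 0 < e ->
  mu2.-integrable (D r : set (plane R)) (EFin \o (fun z => `|F z| ^+ 2 * W z)) ->
  exists N, \int[mu2]_(z in D r) (`|err N z| ^+ 2 * W z) < e.
Proof.
move=> e0 iF; have mDr := measurable_slice_ball HI r0.
have rr : 0 < r <= r by rewrite r0 lexx.
pose A n := \int[mu2]_(z in D (radius n)) (`|F z| ^+ 2 * W z).
pose B N n := \int[mu2]_(z in D (radius n)) (`|spoly a N z| ^+ 2 * W z).
pose E N n := \int[mu2]_(z in D (radius n)) (`|err N z| ^+ 2 * W z).
pose Ar := \int[mu2]_(z in D r) (`|F z| ^+ 2 * W z).
pose Br N := \int[mu2]_(z in D r) (`|spoly a N z| ^+ 2 * W z).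
have W0 z := weight_ge0 HI r alpha0 z.
have sq0 (u : R * R -> quaternion R) z : 0 <= `|u z| ^+ 2 * W z.
  by rewrite mulr_ge0// sqr_ge0.
have msq (u : R * R -> quaternion R) : (forall z, D r z -> u @ z --> u z) ->
    measurable_fun (D r : set (plane R)) ((fun z => `|u z| ^+ 2 * W z) : plane R -> R).
  move=> cu; apply: measurable_funM; last exact: measurable_weight.
  apply: continuous_at_measurable => // z Dz.
  by apply: cvgM; apply: cvg_norm; exact: cu.
have cP N z : D r z -> spoly a N @ z --> spoly a N z by move=> _; exact: cvg_spoly.
have iP N : mu2.-integrable (D r : set (plane R))
    (EFin \o (fun z => `|spoly a N z| ^+ 2 * W z)).
  apply: continuous_integrable => // z.
  by apply: cvgM; apply: cvg_norm; exact: cvg_spoly.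
have finE (h : R * R -> R) s : 0 < s -> mu2.-integrable (D s : set (plane R)) (EFin \o h) ->
    (\int[mu2]_(z in D s) (h z)%:E = (\int[mu2]_(z in D s) h z)%:E)%E.
  move=> s0 ih; rewrite /Rintegral fineK//; apply: integrable_fin_num => //.
  exact: measurable_slice_ball.
have rn0 n : 0 < radius n by have /andP[] := radius_itv n.
have cvgA : A n @[n --> \oo] --> Ar.
  have := cvg_integral_radius (msq F (fun z Dz => @cvg_F z Dz)) (sq0 F).
  rewrite finE// => /fine_cvgP[_]; exact.
have cvgBN N : B N n @[n --> \oo] --> Br N.
  have := cvg_integral_radius (msq _ (cP N)) (sq0 _).
  rewrite finE// => /fine_cvgP[_]; exact.
have EAB N n : E N n = A n - B N n.
  by have [_ _] := spoly_pythagoras N (radius_itv n); rewrite -/(A n) -/(B N n) => ->;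
    rewrite addrC addKr.
have Er N : \int[mu2]_(z in D r) (`|err N z| ^+ 2 * W z) = Ar - Br N.
  have cE := cvg_integral_radius (msq _ (fun z Dz => @cvg_err N z Dz)) (sq0 (err N)).
  have cE' : (E N n)%:E @[n --> \oo] --> (Ar - Br N)%:E.
    apply: cvg_EFin; first exact: nearW.
    under eq_fun do rewrite EAB.
    exact: cvgB cvgA (cvgBN N).
  rewrite /Rintegral -[RHS]/(fine (Ar - Br N)%:E); congr fine.
  apply: (cvg_unique (@ereal_hausdorff R) _ cE').
  rewrite (_ : (fun n => (E N n)%:E) =
      fun n => (\int[mu2]_(z in D (radius n)) (`|err N z| ^+ 2 * W z)%:E)%E) //.
  apply/funext => n; rewrite finE//.
  by have [_ ? _] := spoly_pythagoras N (radius_itv n).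
have BBr N n : B N n <= Br N.
  have sub : D (radius n) `<=` D r.
    by move=> z; apply: sub_ball; have /andP[_ /ltW] := radius_itv n.
  rewrite -lee_fin -!finE//.
    apply: ge0_subset_integral => //; first exact: measurable_slice_ball.
      by apply/measurable_EFinP; exact: msq (cP N).
    by move=> z _; rewrite lee_fin sq0.
  by apply: integrableS (iP N) => //; exact: measurable_slice_ball.
have e2 : 0 < e / 2 by rewrite divr_gt0.
have [n An] : exists n, Ar - A n < e / 2.
  have /cvgrPdist_lt/(_ _ e2)[n _ /(_ n)/= /(_ (leqnn _)) h] := cvgA.
  by exists n; rewrite (le_lt_trans (ler_norm _)).
have [N EN] : exists N, E N n < e / 2.
  have /andP[n0 nr] := radius_itv n; have nr' : 0 < radius n <= r by rewrite n0 ltW.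
  have [C [q [C0 /andP[q0 q1] faN]]] := fa (radius_itv n).
  pose w := \int[mu2]_(z in D (radius n)) W z.
  have cq : (fun N => (C * q ^+ N) ^+ 2 * w) @ \oo --> (0 : R).
    have h : (fun N => C * q ^+ N) @ \oo --> (0 : R).
      rewrite -[0 in X in _ --> X](mulr0 C); apply: cvgM; first exact: cvg_cst.
      by apply: cvg_expr; rewrite ger0_norm.
    rewrite (_ : (fun N => _) = fun N => (C * q ^+ N) * (C * q ^+ N) * w).
      rewrite -[0 in X in _ --> X](mul0r w); apply: cvgM; last exact: cvg_cst.
      by rewrite -[0 in X in _ --> X](mul0r 0); apply: cvgM.
    by apply/funext => N; rewrite expr2.
  have /cvgrPdist_lt/(_ _ e2)[N _ /(_ N)/= /(_ (leqnn _)) h] := cq.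
  have {}h : (C * q ^+ N) ^+ 2 * w < e / 2.
    by move: h; rewrite sub0r normrN; apply: le_lt_trans; exact: ler_norm.
  exists N; apply: le_lt_trans h.
  rewrite /w -RintegralZl//; last 2 first.
  - exact: measurable_slice_ball.
  - exact: weight_integrable.
  have [_ iE _] := spoly_pythagoras N (radius_itv n).
  have mD := measurable_slice_ball HI n0.
  apply: le_Rintegral => //.
    exact: (integrableZl mD _ (weight_integrable HI r0 alpha0 nr')).
  move=> z Dz; rewrite ler_wpM2r// lerXn2r ?nnegrE ?mulr_ge0 ?exprn_ge0//.
  by apply: faN; exact: ltW.
exists N; rewrite Er (@le_lt_trans _ _ (Ar - B N n))//.
  by rewrite lerD2l lerN2.
have -> : Ar - B N n = (Ar - A n) + E N n by rewrite EAB addrA subrK.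
by rewrite [e]splitr ltrD.
Qed.

End expansion.

End density.

(** * Monomials *)

Section monomials.
Context {R : realType} (I : quaternion R) (HI : imag_units I).
Local Notation S := (slice I).

Lemma differentiable_monomial n (q : quaternion R) : differentiable (monomial n) q.
Proof.
elim: n => [|n IH].
  rewrite (_ : monomial 0 = cst 1); first exact: differentiable_cst.
  by apply/funext => p; rewrite /monomial expr0.
rewrite (_ : monomial n.+1 = fun p => p * monomial n p).
  exact: differentiable_quatM.
by apply/funext => p; rewrite /monomial exprS.
Qed.

Lemma is_derive_sliceX n (z v : R * R) :
  is_derive z v (fun y => S y ^+ n) (n%:R *: (S v * S z ^+ n.-1)).
Proof.
have dS : is_derive z v S (S v).
  apply/is_derive_cvgP.
  apply: (@cvg_trans _ ((fun=> S v) @ (0 : R)^')); last exact: cvg_cst.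
  apply: near_eq_cvg; near=> h.
  rewrite -sliceB addrK slice_scale scalerA mulVf ?scale1r//.
  by near: h; exact: nbhs_dnbhs_neq.
elim: n => [|n IH].
  rewrite scale0r (_ : (fun y => _) = cst 1); first exact: is_derive_cst.
  by apply/funext => y; rewrite expr0.
rewrite (_ : (fun y => _) = fun y => S y * S y ^+ n); last first.
  by apply/funext => y; rewrite exprS.
apply: (is_derive_eq (is_derive_quatM dS IH)).
rewrite -scalerAr mulrA (slice_comm HI z v) -mulrA.
case: n {IH} => [|n]; first by rewrite scale0r addr0 scale1r.
by rewrite -exprS -[in X in X + _](scale1r (S v * _)) -scalerDl nat1r.
Unshelve. all: by end_near. Qed.

End monomials.

Lemma slice_regular_monomial (R : realType) (r : R) n :
  slice_regular r (@monomial R n).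
Proof.
split=> [q _|I HI z _]; first exact: differentiable_monomial.
move=> fI; have dE (v : R * R) y := is_derive_sliceX HI n y v.
have DE (v y : R * R) : 'D_v fI y = n%:R *: (slice I v * slice I y ^+ n.-1).
  by have [_ <-] := dE v y.
have cD (v y : R * R) : {for y, continuous ('D_v fI)}.
  rewrite (_ : (fun x => _) = fun x => n%:R *: (slice I v * slice I x ^+ n.-1)).
    apply: cvgZl_tmp; apply: cvg_quatM; first exact: cvg_cst.
    by apply: cvg_quatX; exact: continuous_slice.
  by apply/funext => x; exact: DE.
split; [by split; [have [] := dE (1, 0) z|have [] := dE (0, 1) z]|exact: cD..|].
rewrite !DE slice_imag slice_real scale1r mul1r -scalerAr mulrA imag_unit_sqr//.
by rewrite mulN1r scalerN subrr.
Qed.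

Section bergman_monomials.
Context {R : realType} (I : quaternion R) (HI : imag_units I).
Variables (r alpha : R).
Hypotheses (r0 : 0 < r) (alpha0 : 0 < alpha).
Local Notation mu2 := (lebesgue2 R).
Local Notation S := (slice I).
Local Notation D s := (slice_ball s I).
Local Notation W := (weight I r alpha).

Lemma bergman_monomial n : bergman alpha r I (@monomial R n).
Proof.
split; first exact: slice_regular_monomial.
have := @continuous_integrable R I HI r alpha r0 alpha0 r
  (fun z => `|S z ^+ n| ^+ 2); rewrite r0 lexx => /(_ isT); apply => z.
by apply: cvgM; apply: cvg_norm; exact: cvg_power.
Qed.

Lemma sqr_bergman_norm f : bergman_norm alpha r I f ^+ 2 =
  \int[mu2]_(z in D r) (`|f (S z)| ^+ 2 * W z).
Proof.
have -> : \int[mu2]_(z in D r) (`|f (S z)| ^+ 2 * W z) =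
    qre (bergman_dot alpha r I f f).
  by apply: eq_Rintegral => z _; rewrite qreZ qre_qconjM mulrC.
rewrite /bergman_norm sqr_sqrtr//; apply: Rintegral_ge0 => z _.
by rewrite qreZ qre_qconjM mulr_ge0 ?sqr_ge0//; exact: weight_ge0.
Qed.

Lemma bergman_norm_monomial n :
  bergman_norm alpha r I (@monomial R n) ^+ 2 = moment r alpha n.
Proof.
rewrite sqr_bergman_norm -[RHS]/(fine (moment r alpha n)%:E).
rewrite -(integral_moment HI r0 alpha0); congr fine; apply: eq_integral => z _.
congr ((_ * _)%:E).
by rewrite /monomial norm_quatX exprAC sqr_norm_slice.
Qed.

Lemma bergman_dot_monomial m n : m <> n ->
  bergman_dot alpha r I (@monomial R m) (@monomial R n) = 0.
Proof.
move=> /eqP mn; have rr : 0 < r <= r by rewrite r0 lexx.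
have J p : \int[mu2]_(z in D r) qcoord p (W z *: herm I m n z) = 0.
  rewrite -[RHS](herm_orthogonal HI r0 alpha0 p rr mn).
  by apply: eq_Rintegral => z _; rewrite qcoordZ mulrC.
apply: quat_ext.
- by rewrite -[RHS](J 1); apply: eq_Rintegral => z _; rewrite -qre_qcoord.
- by rewrite -[RHS](J (Quat 0 (-1) 0 0)); apply: eq_Rintegral => z _; rewrite -qi_qcoord.
- by rewrite -[RHS](J (Quat 0 0 (-1) 0)); apply: eq_Rintegral => z _; rewrite -qj_qcoord.
- by rewrite -[RHS](J (Quat 0 0 0 (-1))); apply: eq_Rintegral => z _; rewrite -qk_qcoord.
Qed.

Lemma bergman_density f : bergman alpha r I f -> forall eps, 0 < eps ->
  exists2 g, right_span (@monomial R) g &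
    bergman_norm alpha r I (fun q => f q - g q) < eps.
Proof.
move=> [fr fi] eps eps0; have [a fa] := power_series_expansion HI r0 fr.
have [||N hN] := @spoly_mean_approximation R I HI r alpha r0 alpha0 f a fr fa (eps ^+ 2).
- by rewrite exprn_gt0.
- exact: fi.
exists (fun q => \sum_(k < N) monomial k q * a k); first by exists N, a.
have b0 : 0 <= bergman_norm alpha r I (fun q => f q - \sum_(k < N) monomial k q * a k).
  exact: sqrtr_ge0.
rewrite -(ltr_pXn2r (n := 2)) ?nnegrE ?(ltW eps0)//.
by rewrite sqr_bergman_norm.
Qed.

End bergman_monomials.

Theorem proposition3p6 (R : realType) (r alpha : R)
    (r_gt0 : 0 < r) (alpha_gt0 : 0 < alpha)
    (I : quaternion R) (HI : imag_units I) :
  bergman_orthogonal_basis alpha r I (@monomial R) /\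
  forall n : nat,
    bergman_norm alpha r I (@monomial R n) ^+ 2 =
    n`!%:R * r ^+ (2 * n) * Gamma (alpha + 1) / Gamma (n%:R + alpha + 1).
Proof.
split; last by move=> n; rewrite bergman_norm_monomial.
split.
- by move=> n; exact: bergman_monomial.
- move=> n; exists ((r / 2)%:A).
    by rewrite /qball/= normrZ norm_quat1 mulr1 ger0_norm ?divr_ge0 ?ltW//; lra.
  apply/eqP; rewrite -normr_eq0 /monomial norm_quatX normrZ norm_quat1 mulr1.
  by rewrite expf_neq0// normr_eq0 mulf_neq0 ?invr_eq0 ?pnatr_eq0 ?gt_eqF.
- by move=> m n mn; exact: bergman_dot_monomial.
- by move=> f fB eps eps0; exact: bergman_density.
Qed.
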